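(* In the FJ-GA system (defined in the context), the steady-state average download time satisfies $$\mathbb{E}[T_{\text{FJ-GA}}] \ge \sum_{i=1}^k \frac{p_i}{(t+1)\mu - p_i\lambda}\quad\text{for } \lambda < \frac{(t+1)\mu}{\max\{p_1,\dots,p_k\}},$$ and $$\mathbb{E}[T_{\text{FJ-GA}}] \le \eta + \frac{\lambda \sum_{j=0}^{t}\binom{t}{j}(-1)^j \sum_{l=0}^{rj}(-1)^l\binom{rj}{l}(l+1)^{-2}}{\mu^2(1-\lambda\eta)}\quad\text{for } \lambda < 1/\eta,$$ where $\eta = \frac{1}{\mu r}\beta\!\left(t+1,\frac{1}{r}\right)$ and $\beta(x,y)=\int_0^1 v^{x-1}(1-v)^{y-1}dv$.
   Context: Storage model: $k$ objects $f_1,\dots,f_k$ are encoded by a systematic $(n,k)$ linear code and stored on $n$ servers, one symbol per server, with $(r,t)$-availability: for each systematic server $i$ there are $t$ pairwise disjoint recovery groups of $r$ servers (not containing server $i$), from any one of which $f_i$ can be recovered. Requests arrive as a Poisson process of rate $\lambda$; each request independently asks for $f_i$ with probability $p_i$ ($\sum_i p_i=1$). Fork-Join access (FJ-GA system): a request for $f_i$ is replicated into one copy at systematic server $i$ and one copy at each of its $t$ recovery groups; a copy at a recovery group is forked into $r$ sub-copies, one per server of the group, and completes when all sub-copies finish. The request completes when its systematic copy finishes or some recovery-group copy completes, and all outstanding copies/sub-copies are then removed immediately. Each server has a FCFS queue and serves one sub-copy at a time; service times are independent, each $\mathrm{Exp}(\mu)$. Download time is departure minus arrival time, in steady state. *)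

(* Defs.v *)
From HB Require Import structures.
From mathcomp Require Import all_boot all_order all_algebra.
From mathcomp Require Import all_classical all_reals all_analysis.
Set Implicit Arguments. Unset Strict Implicit. Unset Printing Implicit Defensive.
Import Order.TTheory GRing.Theory Num.Theory.
Local Open Scope classical_set_scope.
Local Open Scope ring_scope.

Definition betaR {R : realType} (x y : R) : R :=
  Rintegral lebesgue_measure `[0%R, 1%R]
    (fun v : R => (v `^ (x - 1)) * ((1 - v) `^ (y - 1))).

Definition mutually_independent {d} {Omega : measurableType d} {R : realType}
    (P : probability Omega R) {I : eqType} (E : I -> set (set Omega)) : Prop :=
  forall (J : seq I) (B : I -> set Omega), uniq J ->
    (forall i, i \in J -> E i (B i)) ->
    P (\bigcap_(i in [set` J]) B i) = (\prod_(i <- J) P (B i))%E.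

Definition events_of_real {d} {Omega : measurableType d} {R : realType}
    (X : Omega -> R) : set (set Omega) :=
  [set A | exists2 B : set R, measurable B & A = X @^-1` B].
Definition events_of_fin {Omega : Type} {T : finType} (X : Omega -> T)
    : set (set Omega) :=
  [set A | exists B : set T, A = X @^-1` B].

(** * Sample-path dynamics of the FJ-GA system.
    Servers are 'I_N.  File i : 'I_k is stored systematically at server
    [sys i]; its recovery groups are [rec i j], j : 'I_t.
    [F q] = time at which server q has finished with all sub-copies of the
    requests processed so far (FCFS: a sub-copy of a new request can start at
    server q only at time max(arrival, F q)).
    Processing one request with arrival time [a], requested file [i] and
    per-server service times [s] returns its departure time and the updated
    free times.  A sub-copy at server q finishes at max(a, F q) + s q;
    the request departs at d = min(systematic finish, min over groups of the
    max over the group's servers of their finish); each involved server is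
    then released at min(finish, d) (immediate removal of outstanding copies). *)
Section FJGA.
Context {R : realType} {k N t : nat}.
Variables (sys : 'I_k -> 'I_N) (rec : 'I_k -> 'I_t -> {set 'I_N}).

Definition fj_step (F : 'I_N -> R) (a : R) (i : 'I_k) (s : 'I_N -> R)
    : R * ('I_N -> R) :=
  let fin q := Num.max a (F q) + s q in
  let dep := \big[Num.min/fin (sys i)]_(j < t)
               \big[Num.max/a]_(q in rec i j) fin q in
  (dep, fun q => if (q == sys i) || [exists j, q \in rec i j]
                 then Num.max (F q) (Num.min (fin q) dep) else F q).

(** [A n] arrival time, [C n] requested file, [S n q] service time of the
    sub-copy of request n at server q (requests numbered in arrival order). *)
Fixpoint fj_free (A : nat -> R) (C : nat -> 'I_k) (S : nat -> 'I_N -> R)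
    (n : nat) : 'I_N -> R :=
  match n with
  | 0 => fun _ => 0
  | m.+1 => (fj_step (fj_free A C S m) (A m) (C m) (S m)).2
  end.

Definition fj_departure A C S (n : nat) : R :=
  (fj_step (fj_free A C S n) (A n) (C n) (S n)).1.

(** download time of request n; arrivals A n = X 0 + ... + X n from the
    i.i.d. interarrival times X of the Poisson process (empty system at 0). *)
Definition fj_download (X : nat -> R) (C : nat -> 'I_k) (S : nat -> 'I_N -> R)
    (n : nat) : R :=
  let A m := \sum_(l < m.+1) X l in fj_departure A C S n - A n.

Definition fj_avg X C S (n : nat) : R :=
  n.+1%:R^-1 * \sum_(m < n.+1) fj_download X C S m.
End FJGA.

(* Main.v *)
Require Import Defs.
From HB Require Import structures.
From mathcomp Require Import all_boot all_order all_algebra.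
From mathcomp Require Import all_classical all_reals all_analysis.
From mathcomp Require Import measurable_realfun zify ring lra.
Set Implicit Arguments. Unset Strict Implicit. Unset Printing Implicit Defensive.
Import Order.TTheory GRing.Theory Num.Theory.
Import numFieldNormedType.Exports.
Local Open Scope classical_set_scope.
Local Open Scope ring_scope.

(** Both bounds compare the download times pathwise with the waiting times of
    a Lindley recursion W' = (W + V - X)^+, where X is exponential of rate lam
    and V is independent of the past.

    Upper bound: if a request is only started after the previous one departs,
    every free time is delayed, and V is the service time of one request in an
    empty system.

    Lower bound, for file i: just after a request for i departs at time d, each
    of its t+1 units (the systematic server and the recovery groups) still
    contains a server that is busy until d.  Following in each unit the server
    with the largest free time, whose choice depends on the past only, a
    request for i needs at least the minimum V of t+1 fresh exponential
    services after the later of its arrival and d; V = 0 for other requests.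

    For the recursion, E[(W')^m + (m / lam) (W')^(m-1) | W + V = y] = y^m.
    These identities bound the moments of W in Cesaro mean, and for m = 2 they
    exhibit the partial sums of W as a martingale with orthogonal increments
    plus the Pollaczek-Khinchine drift.  A second moment estimate along squares
    and the monotonicity of partial sums give almost sure convergence of the
    averages. *)

(** * Real sequences *)

(** The averages are bounded in lower and upper limit along almost every path, so no stationary law
    has to exist and a pathwise comparison is enough. The difficulty is independence: the free times
    of different servers are correlated, and a lower bound may only use services that are fresh
    given the past. Time therefore advances in two half steps with sigma-algebras [G n] and [H n],
    revealing first a service and then an interarrival time; Tonelli with the past frozen takes the
    place of conditional expectation.

    For file [i], putting [V = 0] on other requests keeps one arrival stream of rate [lam] instead
    of thinning it. With [nu = (t+1) mu] the moments are [v1 = p_i / nu] and [v2 = 2 p_i / nu^2].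
    Counting waits only where [V > 0] multiplies the mean wait by [p_i], and
    [p_i lam v2 / (2 (1 - lam v1)) + v1] equals [p_i / (nu - p_i lam)].

    In the upper bound [eta] is the mean of a service with tail [e (1 - (1 - e)^r)^t],
    [e = exp (- mu v)], and the double sum is its second moment divided by [2 / mu^2].

    The martingale increments are quadratic in [W], so their second moments require fourth moments
    of [W]. *)

Lemma cesaro_moments_bounded (R : realType) (a c : nat -> nat -> R) (lam v1 : R) :
  0 < lam -> lam * v1 < 1 -> (forall n m, 0 <= a n m) ->
  (forall n, a n 0%N = 1) -> (forall m, a 0%N m.+1 = 0) ->
  (forall m i, 0 <= c m i) ->
  (forall n m, a n.+1 m.+2 + m.+2%:R / lam * a n.+1 m.+1 <=
    a n m.+2 + m.+2%:R * v1 * a n m.+1 + \sum_(i < m.+1) a n (m - i)%N * c m i) ->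
  forall m, exists2 C, 0 <= C & forall K, \sum_(0 <= n < K) a n m <= C * K%:R.
Proof.
move=> lam0 lv a0 an0 a0m c0 rec; elim/ltn_ind => -[|m] IH.
  exists 1 => // K; under eq_bigr do rewrite an0.
  by rewrite sumr_const_nat subn0 mul1r.
(* The remaining terms have order at most [m] in the first factor, so the strong induction
   hypothesis covers them. *)
have [D D0 HD] : exists2 D, 0 <= D & forall K,
    \sum_(0 <= n < K) \sum_(i < m.+1) a n (m - i)%N * c m i <= D * K%:R.
  elim: (m.+1) => [|M [D D0 HD]].
    by exists 0 => // K; rewrite mul0r big1// => n _; rewrite big_ord0.
  have [C C0 HC] : exists2 C, 0 <= C &
      forall K, \sum_(0 <= n < K) a n (m - M)%N <= C * K%:R.
    by apply: IH; rewrite ltnS leq_subr.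
  exists (D + C * c m M); first by rewrite addr_ge0// mulr_ge0.
  move=> K; under eq_bigr do rewrite big_ord_recr/=.
  rewrite big_split/= mulrDl lerD// -mulr_suml mulrAC.
  by rewrite ler_wpM2r.
have e0 : 0 < m.+2%:R * (lam^-1 - v1).
  by rewrite mulr_gt0// subr_gt0 -(ltr_pM2l lam0) mulfV ?gt_eqF.
exists (D / (m.+2%:R * (lam^-1 - v1))); first by rewrite divr_ge0// ltW.
move=> K; rewrite mulrAC ler_pdivlMr//.
apply: le_trans (HD K).
(* Summing the recursion of order [m.+2] telescopes its leading term and controls order [m.+1],
   whose net coefficient [m.+2%:R * (lam^-1 - v1)] is positive by stability. *)
have tel : a K m.+2 + m.+2%:R / lam * \sum_(0 <= n < K) a n.+1 m.+1 <=
    m.+2%:R * v1 * \sum_(0 <= n < K) a n m.+1 +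
    \sum_(0 <= n < K) \sum_(i < m.+1) a n (m - i)%N * c m i.
  elim: K => [|K IHK]; first by rewrite !big_nil !mulr0 a0m !addr0.
  rewrite !big_nat_recr//= !mulrDr.
  by have := rec K m; move: IHK; lra.
have shift : \sum_(0 <= n < K) a n m.+1 <= \sum_(0 <= n < K) a n.+1 m.+1.
  have -> : \sum_(0 <= n < K) a n.+1 m.+1 = \sum_(0 <= n < K.+1) a n m.+1.
    by rewrite big_nat_recl//= a0m add0r.
  by rewrite big_nat_recr//= lerDl.
have h : m.+2%:R / lam * \sum_(0 <= n < K) a n m.+1 <=
    m.+2%:R / lam * \sum_(0 <= n < K) a n.+1 m.+1.
  by rewrite ler_wpM2l// divr_ge0// ltW.
rewrite mulrC mulrBr mulrBl.
by move: tel h (a0 K m.+2); lra.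
Qed.

Lemma exists_sqr_bracket N : exists s, (s.+1 ^ 2 <= N.+1 < s.+2 ^ 2)%N.
Proof.
elim: N => [|N [s /andP[s1 s2]]]; first by exists 0%N.
have [h|h] := ltnP N.+2 (s.+2 ^ 2).
  by exists s; rewrite h andbT (leq_trans s1).
exists s.+1; rewrite h/=; apply: leq_ltn_trans s2 _.
by rewrite ltn_exp2r.
Qed.

(* A nonnegative sequence has monotone partial sums, so its Cesaro means
   between two consecutive squares are squeezed. *)
Lemma cesaro_cvg_sqr (R : realType) (u : nat -> R) (l : R) :
  (forall n, 0 <= u n) ->
  (fun k => ((k.+1 ^ 2)%:R)^-1 * \sum_(0 <= n < k.+1 ^ 2) u n) @ \oo --> l ->
  (fun n => n.+1%:R^-1 * \sum_(0 <= m < n.+1) u m) @ \oo --> l.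
Proof.
move=> u0; set b := (fun k => _) => bl.
have [s Hs] := choice exists_sqr_bracket.
have sy : s @ \oo --> \oo.
  apply/cvgnyPge => A; exists (A.+2 ^ 2)%N => // n /= An.
  have /andP[_ h] := Hs n; rewrite leqNgt; apply/negP => sA.
  have : (A.+2 ^ 2 < A.+2 ^ 2)%N.
    apply: (leq_ltn_trans An); apply: (ltn_trans (ltnSn n)).
    by apply: (leq_trans h); rewrite leq_exp2r// ltnS ltnW.
  by rewrite ltnn.
have r1 : (fun k => 1 - harmonic k.+1 : R) @ \oo --> (1 : R).
  suff : (fun k => 1 - harmonic k.+1 : R) @ \oo --> (1 - 0 : R).
    by rewrite subr0.
  apply: cvgB; first exact: cvg_cst.
  rewrite (cvg_shiftS (@harmonic R)); exact: cvg_harmonic.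
have r2 : (fun k => 1 + harmonic k : R) @ \oo --> (1 : R).
  suff : (fun k => 1 + harmonic k : R) @ \oo --> (1 + 0 : R).
    by rewrite addr0.
  apply: cvgD; [exact: cvg_cst|exact: cvg_harmonic].
(* The squares of [1 - harmonic k.+1 = (k+1)/(k+2)] and [1 + harmonic k = (k+2)/(k+1)] exchange the
   normalisations [(k+1)^2] and [(k+2)^2], and both factors tend to 1. *)
have hl : (fun k => b k * (1 - harmonic k.+1) ^+ 2) @ \oo --> l.
  under eq_fun do rewrite expr2.
  suff : (fun k => b k * ((1 - harmonic k.+1) * (1 - harmonic k.+1))) @ \oo -->
      l * (1 * 1) by rewrite !mulr1.
  by apply: cvgM => //; exact: cvgM.
have hu : (fun k => b k.+1 * (1 + harmonic k) ^+ 2) @ \oo --> l.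
  under eq_fun do rewrite expr2.
  suff : (fun k => b k.+1 * ((1 + harmonic k) * (1 + harmonic k))) @ \oo -->
      l * (1 * 1) by rewrite !mulr1.
  by apply: cvgM; [rewrite (cvg_shiftS b)|exact: cvgM].
apply: (@squeeze_cvgr _ _ _ _ _ _ _ _ _ (cvg_comp _ _ sy hl) (cvg_comp _ _ sy hu)).
apply: nearW => n /=; have /andP[h1 h2] := Hs n.
set k := s n in h1 h2 *.
have mono p q : (p <= q)%N -> \sum_(0 <= m < p) u m <= \sum_(0 <= m < q) u m.
  move=> pq; rewrite (big_cat_nat _ pq)//= lerDl.
  by apply: sumr_ge0.
have n0 : 0 < n.+1%:R :> R by [].
have k0 : 0 < k.+1%:R :> R by [].
have k1 : 0 < k.+2%:R :> R by [].
have S0 p : 0 <= \sum_(0 <= m < p) u m by apply: sumr_ge0.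
have e1 : 1 - k.+2%:R^-1 = k.+1%:R / k.+2%:R :> R.
  have -> : k.+2%:R = k.+1%:R + 1 :> R by rewrite -[k.+2]addn1 natrD.
  by field; rewrite gt_eqF// addr_gt0.
have e2 : 1 + k.+1%:R^-1 = k.+2%:R / k.+1%:R :> R.
  have -> : k.+2%:R = k.+1%:R + 1 :> R by rewrite -[k.+2]addn1 natrD.
  by field; rewrite gt_eqF.
rewrite /b /harmonic/= e1 e2 !natrX.
have h1' : k.+1%:R ^+ 2 <= n.+1%:R :> R by rewrite -natrX ler_nat.
have h2' : n.+1%:R <= k.+2%:R ^+ 2 :> R by rewrite -natrX ler_nat ltnW.
apply/andP; split.
- have -> : (k.+1%:R ^+ 2)^-1 * (\sum_(0 <= m < k.+1 ^ 2) u m) *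
    (k.+1%:R / k.+2%:R) ^+ 2 = (k.+2%:R ^+ 2)^-1 * \sum_(0 <= m < k.+1 ^ 2) u m :> R.
    by move: (k.+1%:R) (k.+2%:R) k0 k1 => x y x0 y0; field; rewrite !gt_eqF.
  apply: ler_pM => //; last by apply: mono; exact: h1.
  by rewrite lef_pV2// posrE exprn_gt0.
- have -> : (k.+2%:R ^+ 2)^-1 * (\sum_(0 <= m < k.+2 ^ 2) u m) *
    (k.+2%:R / k.+1%:R) ^+ 2 = (k.+1%:R ^+ 2)^-1 * \sum_(0 <= m < k.+2 ^ 2) u m :> R.
    by move: (k.+1%:R) (k.+2%:R) k0 k1 => x y x0 y0; field; rewrite !gt_eqF.
  apply: ler_pM => //; last by apply: mono; exact: ltnW.
  by rewrite lef_pV2// posrE exprn_gt0.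
Qed.

(** * Independence and orthogonal increments *)

Section independence.
Context d d1 d2 (Omega : measurableType d) (T1 : measurableType d1)
  (T2 : measurableType d2) (R : realType) (P : probability Omega R).
Variables (Y : Omega -> T1) (Z : Omega -> T2).
Hypotheses (mY : measurable_fun setT Y) (mZ : measurable_fun setT Z).
Hypothesis YZ : forall A B, measurable A -> measurable B ->
  P (Y @^-1` A `&` Z @^-1` B) = (P (Y @^-1` A) * P (Z @^-1` B))%E.

(** The joint law agrees with the product law on rectangles, hence everywhere; Tonelli then
    integrates [Z] with [Y] frozen. *)
Lemma ge0_integral_indep (h : T1 * T2 -> \bar R) :
  measurable_fun [set: T1 * T2] h -> (forall x, 0 <= h x)%E ->
  (\int[P]_w h (Y w, Z w) = \int[P]_w \int[P]_w' h (Y w, Z w'))%E.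
Proof.
move=> mh h0.
pose Y' : {mfun Omega >-> T1} := mfun_Sub (mem_set mY).
pose Z' : {mfun Omega >-> T2} := mfun_Sub (mem_set mZ).
pose W' : {mfun Omega >-> (T1 * T2)%type} :=
  mfun_Sub (mem_set (measurable_fun_pair mY mZ)).
transitivity (\int[distribution P W']_z h z)%E.
  by rewrite ge0_integral_pushforward.
transitivity (\int[distribution P Y' \x distribution P Z']_z h z)%E.
  apply: eq_measure_integral => A mA _; apply/esym.
  by apply: product_measure_unique => // B C mB mC; exact: YZ.
rewrite fubini_tonelli1// ge0_integral_pushforward//=.
- apply: eq_integral => w _ /=; rewrite /fubini_F ge0_integral_pushforward//.
  exact: measurableT_comp.
- exact: measurable_fun_fubini_tonelli_F.
- by move=> x _; apply: integral_ge0 => *; exact: h0.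
Qed.

(** For each frozen [w] the positive and negative parts have the same inner integral, hence the same
    total integral, which integrability makes finite. *)
Lemma integral_indep0 (h : T1 * T2 -> R) : measurable_fun [set: T1 * T2] h ->
  (forall w, \int[P]_w' (h (Y w, Z w'))%:E = 0)%E ->
  P.-integrable setT (fun w => (h (Y w, Z w))%:E) ->
  (\int[P]_w (h (Y w, Z w))%:E = 0)%E.
Proof.
move=> mh h0 ih.
have mEh : measurable_fun [set: T1 * T2] (EFin \o h) by exact/measurable_EFinP.
have mp : measurable_fun [set: T1 * T2] ((EFin \o h)^\+)%E.
  exact: measurable_funepos.
have mn : measurable_fun [set: T1 * T2] ((EFin \o h)^\-)%E.
  exact: measurable_funeneg.
have pE w : (fun w' => (h (Y w, Z w'))%:E)^\+%E =
    (fun w' => (EFin \o h)^\+%E (Y w, Z w')).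
  by apply/funext => w'; rewrite !funeposE.
have nE w : (fun w' => (h (Y w, Z w'))%:E)^\-%E =
    (fun w' => (EFin \o h)^\-%E (Y w, Z w')).
  by apply/funext => w'; rewrite !funenegE.
have fN : (\int[P]_w (fun w => (h (Y w, Z w))%:E)^\- w)%E \is a fin_num.
  by apply: integrable_fin_num => //; exact: integrable_funeneg.
rewrite integralE -[X in (X - _)%E](_ : \int[P]_w (EFin \o h)^\- (Y w, Z w) = _)%E.
  rewrite -[X in (_ - X)%E](_ : \int[P]_w (EFin \o h)^\- (Y w, Z w) = _)%E.
    rewrite subee// (_ : \int[P]_w _ = \int[P]_w (fun w => (h (Y w, Z w))%:E)^\- w)%E//.
    by apply: eq_integral => w _; rewrite !funenegE.
  by apply: eq_integral => w _; rewrite !funenegE.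
transitivity (\int[P]_w ((EFin \o h)^\+ (Y w, Z w)))%E; last first.
  by apply: eq_integral => w _; rewrite !funeposE.
rewrite !ge0_integral_indep//.
apply: eq_integral => w _; have := h0 w.
rewrite integralE pE nE.
have : (0 <= \int[P]_w' ((EFin \o h)^\+ (Y w, Z w')))%E.
  by apply: integral_ge0 => *; exact: funepos_ge0.
have : (0 <= \int[P]_w' ((EFin \o h)^\- (Y w, Z w')))%E.
  by apply: integral_ge0 => *; exact: funeneg_ge0.
(* The value 0 excludes infinite parts, because [+oo - +oo] is [-oo] by convention. *)
case: (\int[P]_w' _)%E => [a||]; case: (\int[P]_w' _)%E => [b||]//= _ _ [] /eqP.
by rewrite subr_eq0 => /eqP ->.
Qed.

End independence.

Lemma cvg_sqr0 (R : realType) (u : nat -> R) :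
  (fun n => u n ^+ 2) @ \oo --> 0 -> u @ \oo --> 0.
Proof.
move=> /cvgr0Pnorm_lt H; apply/cvgr0Pnorm_lt => e e0.
apply: filterS (H _ (exprn_gt0 2 e0)) => n.
by rewrite normrX ltr_pXn2r// nnegrE ?normr_ge0// ltW.
Qed.

Section orthogonal_slln.
Context d (Omega : measurableType d) (R : realType) (P : probability Omega R).

(** Bounded total expectation makes the series finite almost everywhere, so its terms tend to 0.
    This does the work of Borel-Cantelli. *)
Lemma ge0_ae_cvg_series (g : nat -> Omega -> R) (b : R) :
  (forall n, measurable_fun setT (g n)) -> (forall n w, 0 <= g n w) ->
  (forall K, \sum_(0 <= n < K) \int[P]_w (g n w)%:E <= b%:E)%E ->
  {ae P, forall w, (g ^~ w) @ \oo --> 0}.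
Proof.
move=> mg g0 gb.
have mEg n : measurable_fun setT (fun w => (g n w)%:E) by exact/measurable_EFinP.
have int : P.-integrable setT (fun w => \sum_(0 <= n <oo) (g n w)%:E)%E.
  apply/integrableP; split.
    by apply: ge0_emeasurable_sum => // n w _ _; rewrite lee_fin.
  under eq_integral => w _.
    rewrite gee0_abs; last by apply: nneseries_ge0 => *; rewrite lee_fin.
    over.
  rewrite /= integral_nneseries//; last by move=> *; rewrite lee_fin.
  apply: le_lt_trans (ltry b); apply: lime_le; last exact: nearW.
  by apply: is_cvg_nneseries => *; apply: integral_ge0 => *; rewrite lee_fin.
have := integrable_ae measurableT int; apply: filterS => w /(_ I) fin.
apply: cvg_series_cvg_0; apply: nondecreasing_is_cvgn.
  by apply/nondecreasing_seqP => n; rewrite /series/= big_nat_recr//= lerDl.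
exists (fine (\sum_(0 <= n <oo) (g n w)%:E)%E) => _ [K _ <-].
rewrite -lee_fin fineK// /series/= -sumEFin.
by apply: nneseries_lim_ge => *; rewrite lee_fin.
Qed.

Lemma sum_inv_sqr_le2 K : \sum_(0 <= k < K) (k.+1%:R ^+ 2)^-1 <= 2 :> R.
Proof.
(* Strengthened for the induction: the slack [1/(m+1)] absorbs the next term. *)
suff H m : \sum_(0 <= k < m.+1) (k.+1%:R ^+ 2)^-1 <= 2 - m.+1%:R^-1 :> R.
  case: K => [|K]; first by rewrite big_nil.
  by apply: (le_trans (H K)); rewrite lerBlDr lerDl.
elim: m => [|m IH]; first by rewrite big_nat1 expr1n invr1; lra.
rewrite big_nat_recr//=; apply: (le_trans (lerD IH (lexx _))).
have a0 : 0 < m.+1%:R :> R by [].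
have -> : m.+2%:R = m.+1%:R + 1 :> R by rewrite -[m.+2]addn1 natrD.
move: (m.+1%:R) a0 => a a0.
rewrite -addrA lerD2l -subr_ge0.
have -> : - (a + 1)^-1 - (- a^-1 + ((a + 1) ^+ 2)^-1) = (a * (a + 1) ^+ 2)^-1.
  by field; rewrite !gt_eqF// addr_gt0.
by rewrite invr_ge0 mulr_ge0 ?sqr_ge0 ?ltW.
Qed.

Variables (D : nat -> Omega -> R) (c : R).
Hypothesis mD : forall n, measurable_fun setT (D n).
Hypothesis D2 : forall n, P.-integrable setT (fun w => (D n w ^+ 2)%:E).
Hypothesis DD : forall m n, (m < n)%N -> (\int[P]_w (D m w * D n w)%:E = 0)%E.
Hypothesis Dc : forall K,
  (\sum_(0 <= n < K) \int[P]_w (D n w ^+ 2)%:E <= (c * K%:R)%:E)%E.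

Let S K w : R := \sum_(0 <= n < K) D n w.

Let mS K : measurable_fun setT (S K).
Proof. exact: measurable_sum. Qed.

Let integrableM2 (f g : Omega -> R) :
  measurable_fun setT f -> measurable_fun setT g ->
  P.-integrable setT (fun w => (f w ^+ 2)%:E) ->
  P.-integrable setT (fun w => (g w ^+ 2)%:E) ->
  P.-integrable setT (fun w => (f w * g w)%:E).
Proof.
move=> mf mg f2 g2; apply: le_integrable (integrableD measurableT f2 g2) => //.
  exact/measurable_EFinP/measurable_funM.
move=> w _ /=; rewrite lee_fin [leRHS]ger0_norm ?addr_ge0 ?sqr_ge0// ler_norml.
by apply/andP; split; nra.
Qed.

Let SD K n : (K <= n)%N -> P.-integrable setT (fun w => (S K w ^+ 2)%:E) ->
  (\int[P]_w (S K w * D n w)%:E = 0)%E.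
Proof.
move=> Kn S2; under eq_integral do rewrite /S mulr_suml -sumEFin.
rewrite integral_sum//; last by move=> m; exact: integrableM2.
rewrite big_nat big1// => m /andP[_ mK]; apply: DD; exact: leq_trans Kn.
Qed.

Let S2 K : P.-integrable setT (fun w => (S K w ^+ 2)%:E) /\
  (\int[P]_w (S K w ^+ 2)%:E = \sum_(0 <= n < K) \int[P]_w (D n w ^+ 2)%:E)%E.
Proof.
elim: K => [|K [IH1 IH2]].
  have S0 : (fun w => (S 0 w ^+ 2)%:E) = cst 0%E.
    by apply/funext => w; rewrite /S big_nil expr0n.
  rewrite S0 big_nil; split; first exact: integrable0.
  by rewrite integral0.
have SE : (fun w => (S K.+1 w ^+ 2)%:E) = (fun w =>
    (S K w ^+ 2)%:E + (2%:E * (S K w * D K w)%:E + (D K w ^+ 2)%:E))%E.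
  apply/funext => w; rewrite /S big_nat_recr//= -/(S K w) -!EFinM -!EFinD.
  by congr EFin; ring.
have i1 : P.-integrable setT (fun w => (S K w * D K w)%:E).
  exact: integrableM2.
have i2 : P.-integrable setT (fun w => 2%:E * (S K w * D K w)%:E)%E.
  exact: integrableZl.
have i3 : P.-integrable setT
    (fun w => 2%:E * (S K w * D K w)%:E + (D K w ^+ 2)%:E)%E.
  exact: integrableD.
rewrite SE; split; first exact: integrableD.
by rewrite integralD// integralD// integralZl// SD// mule0 add0e IH2 big_nat_recr.
Qed.

(** By orthogonality [S K] has second moment at most [c * K], so the average over [K] terms has
    second moment at most [c / K]. This is summable along [K = (k+1)^2], though not along all
    [K]. *)
Lemma orthogonal_slln_sqr : {ae P, forall w,
  (fun k => ((k.+1 ^ 2)%:R)^-1 * \sum_(0 <= n < k.+1 ^ 2) D n w) @ \oo --> 0}.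
Proof.
have c0 : 0 <= c.
  have := Dc 1; rewrite big_nat1 mulr1 -lee_fin; apply: le_trans.
  by apply: integral_ge0 => w _; rewrite lee_fin sqr_ge0.
have := @ge0_ae_cvg_series
  (fun k w => (((k.+1 ^ 2)%:R)^-1 * S (k.+1 ^ 2) w) ^+ 2) (c * 2) _ _ _.
case=> [n|n w|K|A [mA PA0 sA]].
- by apply: measurable_funX; exact: measurable_funM.
- exact: sqr_ge0.
- apply: (@le_trans _ _ (\sum_(0 <= k < K) (c * (k.+1%:R ^+ 2)^-1)%:E)%E).
    apply: lee_sum => k _; under eq_integral do rewrite exprMn EFinM.
    rewrite integralZl//; last exact: (S2 _).1.
    rewrite (S2 _).2.
    apply: (@le_trans _ _ ((((k.+1 ^ 2)%:R)^-1 ^+ 2)%:E * (c * (k.+1 ^ 2)%:R)%:E)%E).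
      by apply: lee_wpmul2l; rewrite ?lee_fin ?sqr_ge0.
    rewrite -EFinM lee_fin natrX le_eqVlt; apply/orP; left; apply/eqP.
    have : k.+1%:R != 0 :> R by rewrite pnatr_eq0.
    by move: (k.+1%:R) => a a0; field.
  by rewrite sumEFin lee_fin -mulr_sumr ler_wpM2l// sum_inv_sqr_le2.
exists A; split => // w Hw; apply: sA => /= Hc; apply: Hw.
exact: cvg_sqr0.
Qed.

End orthogonal_slln.

Section sub_sigma_algebra.
Context d (Omega : measurableType d) (R : realType) (P : probability Omega R).
Implicit Types (G : set (set Omega)) (f : Omega -> R).

Definition measurable_wrt G f :=
  measurable_fun setT (f : g_sigma_algebraType G -> R).

Lemma measurable_wrtP G f :
  (forall B, measurable B -> <<s G >> (f @^-1` B)) -> measurable_wrt G f.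
Proof. by move=> h _ B mB; rewrite setTI; exact: h. Qed.

Lemma measurable_wrtS G1 G2 f : <<s G1 >> `<=` <<s G2 >> ->
  measurable_wrt G1 f -> measurable_wrt G2 f.
Proof. by move=> G12 mf _ B mB; apply: G12; exact: mf. Qed.

Lemma measurable_wrt_fun G f : <<s G >> `<=` measurable ->
  measurable_wrt G f -> measurable_fun setT f.
Proof. by move=> Gm mf _ B mB; apply: Gm; exact: mf. Qed.

Definition indep_of G f := forall A B, <<s G >> A -> measurable B ->
  P (A `&` f @^-1` B) = (P A * P (f @^-1` B))%E.

Variables (G : set (set Omega)) (xi : Omega -> R).
Hypotheses (mG : <<s G >> `<=` measurable) (mxi : measurable_fun setT xi).
Hypothesis ind : indep_of G xi.

(** The whole past becomes a single random element: the identity map into [Omega] equipped with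
    [<<s G >>]. Whatever is measurable with respect to [G] is then an ordinary measurable function
    of it, and the independence lemmas for pairs apply. *)
Let id_meas : measurable_fun setT (id : Omega -> g_sigma_algebraType G).
Proof. by move=> _ B mB; rewrite setTI; exact: mG. Qed.

Let mpair (U : Omega -> R) (g : R * R -> R) : measurable_wrt G U ->
  measurable_fun setT g ->
  measurable_fun [set: g_sigma_algebraType G * R] (fun z => g (U z.1, z.2)).
Proof.
move=> mU mg; apply: (measurableT_comp mg); apply: measurable_fun_pair.
  exact: (@measurableT_comp _ _ _ _ _ _ (U : g_sigma_algebraType G -> R)).
exact: measurable_snd.
Qed.

Lemma ge0_integral_indep_of (U : Omega -> R) (g : R * R -> R) :
  measurable_wrt G U -> measurable_fun setT g -> (forall w x, 0 <= g (U w, x)) ->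
  (\int[P]_w (g (U w, xi w))%:E = \int[P]_w \int[P]_w' (g (U w, xi w'))%:E)%E.
Proof.
move=> mU mg g0.
have := @ge0_integral_indep _ _ _ Omega (g_sigma_algebraType G) R _ P id xi
  id_meas mxi ind (fun z => (g (U z.1, z.2))%:E).
apply; last by move=> [w x]; rewrite lee_fin.
by apply/measurable_EFinP; exact: (mpair mU mg).
Qed.

(** The factor [Z] is meant for an earlier increment: a zero mean with the past frozen becomes
    orthogonality. *)
Lemma integral_indep_of0 (Z U : Omega -> R) (g : R * R -> R) :
  measurable_wrt G Z -> measurable_wrt G U -> measurable_fun setT g ->
  (forall w, P.-integrable setT (fun w' => (g (U w, xi w'))%:E)) ->
  (forall w, \int[P]_w' (g (U w, xi w'))%:E = 0)%E ->
  P.-integrable setT (fun w => (Z w * g (U w, xi w))%:E) ->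
  (\int[P]_w (Z w * g (U w, xi w))%:E = 0)%E.
Proof.
move=> mZ mU mg ig g0.
apply: (@integral_indep0 _ _ _ Omega (g_sigma_algebraType G) R _ P id xi
  id_meas mxi ind (fun z => Z z.1 * g (U z.1, z.2))).
  apply: measurable_funM; last exact: (mpair mU mg).
  exact: (@measurableT_comp _ _ _ _ _ _ (Z : g_sigma_algebraType G -> R)).
by move=> w /=; under eq_integral do rewrite EFinM; rewrite integralZl// g0 mule0.
Qed.

End sub_sigma_algebra.

Section innovation_slln.
Context d (Omega : measurableType d) (R : realType) (P : probability Omega R).
Variables (G : nat -> set (set Omega)) (xi U : nat -> Omega -> R).
Variables (g : R * R -> R) (c : R).
Hypothesis mG : forall n, <<s G n >> `<=` measurable.
Hypothesis ndG : forall n, <<s G n >> `<=` <<s G n.+1 >>.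
Hypothesis mxi : forall n, measurable_wrt (G n.+1) (xi n).
Hypothesis ind : forall n, indep_of P (G n) (xi n).
Hypothesis mU : forall n, measurable_wrt (G n) (U n).
Hypothesis mg : measurable_fun setT g.
Hypothesis ig : forall n w, P.-integrable setT (fun w' => (g (U n w, xi n w'))%:E).
Hypothesis g0 : forall n w, (\int[P]_w' (g (U n w, xi n w'))%:E = 0)%E.
Hypothesis g2 : forall n,
  P.-integrable setT (fun w => (g (U n w, xi n w) ^+ 2)%:E).
Hypothesis gc : forall K, (\sum_(0 <= n < K)
  \int[P]_w (g (U n w, xi n w) ^+ 2)%:E <= (c * K%:R)%:E)%E.

Let D n w := g (U n w, xi n w).

Let mDG n : measurable_wrt (G n.+1) (D n).
Proof.
apply: (@measurableT_comp _ _ _ (g_sigma_algebraType (G n.+1)) _ _ g setT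
  (fun w => (U n w, xi n w)) mg).
apply: (@measurable_fun_pair _ _ _ (g_sigma_algebraType (G n.+1)) R R).
  exact: (measurable_wrtS (@ndG n) (@mU n)).
exact: mxi.
Qed.

Let mD n : measurable_fun setT (D n).
Proof. exact: measurable_wrt_fun (@mDG n). Qed.

Let subG m n : (m <= n)%N -> <<s G m >> `<=` <<s G n >>.
Proof.
elim: n => [|n IH]; first by rewrite leqn0 => /eqP ->.
rewrite leq_eqVlt => /orP[/eqP ->//|mn].
exact: subset_trans (IH mn) (@ndG n).
Qed.

(** For [m < n] the increment [D m] is measurable with respect to [G n], while [D n] has mean zero
    over [xi n] for every frozen value of [U n]; so the increments are orthogonal. *)
Lemma innovation_slln_sqr : {ae P, forall w, (fun k => ((k.+1 ^ 2)%:R)^-1 *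
  \sum_(0 <= n < k.+1 ^ 2) g (U n w, xi n w)) @ \oo --> 0}.
Proof.
apply: (@orthogonal_slln_sqr _ _ _ P D c) => // m n mn.
apply: (@integral_indep_of0 _ _ _ P (G n)) => //.
- exact: (measurable_wrt_fun (@mG n.+1)).
- exact: (measurable_wrtS (subG mn)).
apply: le_integrable (integrableD measurableT (g2 m) (g2 n)) => //.
  by apply/measurable_EFinP; exact: (measurable_funM (@mD m) (@mD n)).
move=> w _ /=; rewrite lee_fin [leRHS]ger0_norm ?addr_ge0 ?sqr_ge0// ler_norml.
by rewrite /D; apply/andP; split; nra.
Qed.

End innovation_slln.

(** * The Lindley recursion *)

Lemma sqrrD_le (R : realDomainType) (x y : R) :
  (x + y) ^+ 2 <= 2 * x ^+ 2 + 2 * y ^+ 2.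
Proof.
rewrite -subr_ge0 (_ : _ - _ = (x - y) ^+ 2) ?sqr_ge0//; ring.
Qed.

Lemma sqrrB_le (R : realDomainType) (x y : R) :
  (x - y) ^+ 2 <= 2 * x ^+ 2 + 2 * y ^+ 2.
Proof. by have := sqrrD_le x (- y); rewrite sqrrN. Qed.

Lemma mulr_sqr_le (R : realDomainType) (x y : R) :
  2 * (x * y) <= x ^+ 2 + y ^+ 2.
Proof.
rewrite -subr_ge0 (_ : _ - _ = (x - y) ^+ 2) ?sqr_ge0//; ring.
Qed.

(** [X m] is the gap between customers [m] and [m.+1]; the queue below therefore passes its
    interarrival times shifted by one. It starts empty. *)
Fixpoint lindley {R : realType} (V X : nat -> R) (n : nat) : R :=
  if n is m.+1 then Num.max 0 (lindley V X m + V m - X m) else 0.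

Lemma lindley_ge0 (R : realType) (V X : nat -> R) n : 0 <= lindley V X n.
Proof. by case: n => //= n; rewrite le_max lexx. Qed.

Section lindley_slln.
Context d (Omega : measurableType d) (R : realType) (P : probability Omega R).
Variables (G H : nat -> set (set Omega)) (V X : nat -> Omega -> R).
Variables (lam v1 v2 p : R) (B : nat -> R).
Hypothesis mH : forall n, <<s H n >> `<=` measurable.
Hypothesis GH : forall n, <<s G n >> `<=` <<s H n >>.
Hypothesis HG : forall n, <<s H n >> `<=` <<s G n.+1 >>.
Hypothesis mV : forall n, measurable_wrt (H n) (V n).
Hypothesis mX : forall n, measurable_wrt (G n.+1) (X n).
Hypothesis indV : forall n, indep_of P (G n) (V n).
Hypothesis indX : forall n, indep_of P (H n) (X n).
Hypothesis V0 : forall n w, 0 <= V n w.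
Hypothesis lam0 : 0 < lam.
Hypothesis lv : lam * v1 < 1.
(* With f_m x = x^m + (m / lam) x^(m-1), an exponential X satisfies
   E[f_m ((y - X)^+)] = y^m; this is the only place the law of X enters. *)
Hypothesis EX : forall n m (y : R), 0 <= y ->
  (\int[P]_w (Num.max 0 (y - X n w) ^+ m.+2 +
    m.+2%:R / lam * Num.max 0 (y - X n w) ^+ m.+1)%:E = (y ^+ m.+2)%:E)%E.
Hypothesis EV1 : forall n, (\int[P]_w (V n w)%:E = v1%:E)%E.
Hypothesis EV2 : forall n, (\int[P]_w (V n w ^+ 2)%:E = v2%:E)%E.
Hypothesis EVB : forall n m, (\int[P]_w (V n w ^+ m)%:E <= (B m)%:E)%E.
Hypothesis Vp : forall n, P [set w | 0 < V n w] = p%:E.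

Let mG n : <<s G n >> `<=` measurable.
Proof. exact: subset_trans (@GH n) (@mH n). Qed.

Let W n w := lindley (V ^~ w) (X ^~ w) n.
Let Y n w := W n w + V n w.

Let W0 n w : 0 <= W n w. Proof. exact: lindley_ge0. Qed.
Let Y0 n w : 0 <= Y n w. Proof. exact: addr_ge0. Qed.

Let mW n : measurable_wrt (G n) (W n).
Proof.
elim: n => [|n IH]; first exact: measurable_cst.
have mWn : measurable_wrt (G n.+1) (W n).
  exact: measurable_wrtS (subset_trans (@GH n) (@HG n)) IH.
have mVn : measurable_wrt (G n.+1) (V n) by exact: measurable_wrtS (@HG n) (@mV n).
apply: (@measurable_maxr _ (g_sigma_algebraType (G n.+1)) _ setT (cst 0)
  (fun w => W n w + V n w - X n w)) => //.
by apply: measurable_funB; [exact: measurable_funD|exact: mX].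
Qed.

Let mY n : measurable_wrt (H n) (Y n).
Proof.
apply: (@measurable_funD _ (g_sigma_algebraType (H n)) _ setT (W n) (V n)).
  exact: measurable_wrtS (@GH n) (@mW n).
exact: mV.
Qed.

Let mWf n : measurable_fun setT (W n).
Proof. exact: measurable_wrt_fun (@mW n). Qed.
Let mVf n : measurable_fun setT (V n).
Proof. exact: measurable_wrt_fun (@mV n). Qed.
Let mYf n : measurable_fun setT (Y n).
Proof. exact: measurable_wrt_fun (@mY n). Qed.
Let mXf n : measurable_fun setT (X n).
Proof. exact: measurable_wrt_fun (@mX n). Qed.

Let EW n m : \bar R := (\int[P]_w (W n w ^+ m)%:E)%E.

Let EW_ge0 n m : (0 <= EW n m)%E.
Proof. by apply: integral_ge0 => w _; rewrite lee_fin exprn_ge0. Qed.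

Let EV_ge0 n m : (0 <= \int[P]_w (V n w ^+ m)%:E)%E.
Proof. by apply: integral_ge0 => w _; rewrite lee_fin exprn_ge0. Qed.

Let EV_fin n m : (\int[P]_w (V n w ^+ m)%:E)%E \is a fin_num.
Proof. by rewrite ge0_fin_numE// (le_lt_trans (EVB n m))// ltry. Qed.

Let EY n m : (\int[P]_w (Y n w ^+ m)%:E =
  \sum_(i < m.+1) (EW n (m - i) * ('C(m, i)%:R%:E * \int[P]_w (V n w ^+ i)%:E)))%E.
Proof.
(* Tonelli asks for a nonnegative integrand at every real second argument; clipping provides it and
   changes nothing, as [V n] is nonnegative. *)
pose g (z : R * R) := (z.1 + Num.max 0 z.2) ^+ m.
have mg : measurable_fun setT g.
  apply: measurable_funX; apply: measurable_funD => //.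
  exact: measurable_maxr.
transitivity (\int[P]_w (g (W n w, V n w))%:E)%E.
  by apply: eq_integral => w _; rewrite /g/= max_r.
rewrite (ge0_integral_indep_of (@mG n) (@mVf n) (@indV n) (@mW n) mg); last first.
  move=> w x; apply: exprn_ge0; apply: addr_ge0; first exact: W0.
  by rewrite le_max lexx.
transitivity (\int[P]_w \sum_(i < m.+1) ((W n w ^+ (m - i))%:E *
    ('C(m, i)%:R%:E * \int[P]_w' (V n w' ^+ i)%:E)))%E.
  apply: eq_integral => w _.
  under eq_integral.
    move=> w' _; rewrite /g/= max_r// exprDn -sumEFin.
    under eq_bigr do rewrite -mulr_natl mulrCA mulrA EFinM.
    over.
  rewrite ge0_integral_sum//; last 2 first.
  - move=> i; apply/measurable_EFinP; apply: measurable_funM => //.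
    exact: measurable_funX.
  - by move=> i w' _; rewrite -EFinM lee_fin mulr_ge0 ?mulr_ge0 ?exprn_ge0.
  apply: eq_bigr => i _; rewrite ge0_integralZl_EFin ?mulr_ge0 ?exprn_ge0//.
  - by rewrite EFinM muleA.
  - by move=> w' _; rewrite lee_fin exprn_ge0.
  - exact/measurable_EFinP/measurable_funX.
rewrite ge0_integral_sum//; last 2 first.
- move=> i; apply: emeasurable_funM => //.
  by apply/measurable_EFinP/measurable_funX.
- by move=> i w _; rewrite mule_ge0 ?mule_ge0 ?lee_fin ?exprn_ge0.
apply: eq_bigr => i _; under eq_integral do rewrite muleC.
rewrite ge0_integralZl//; first by rewrite muleC.
- exact/measurable_EFinP/measurable_funX.
- by move=> w _; rewrite lee_fin exprn_ge0.
- by rewrite mule_ge0// lee_fin.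
Qed.

Let EWS n m : (EW n.+1 m.+2 + (m.+2%:R / lam)%:E * EW n.+1 m.+1 =
  \int[P]_w (Y n w ^+ m.+2)%:E)%E.
Proof.
have c0 : 0 <= m.+2%:R / lam by rewrite divr_ge0// ltW.
pose g (z : R * R) := Num.max 0 (z.1 - z.2) ^+ m.+2 +
  m.+2%:R / lam * Num.max 0 (z.1 - z.2) ^+ m.+1.
have mm : measurable_fun setT (fun z : R * R => Num.max 0 (z.1 - z.2)).
  by apply: measurable_maxr => //; exact: measurable_funB.
have mg : measurable_fun setT g.
  apply: measurable_funD; first exact: measurable_funX.
  by apply: measurable_funM => //; exact: measurable_funX.
transitivity (\int[P]_w (g (Y n w, X n w))%:E)%E.
  rewrite -ge0_integralZl_EFin//; last 2 first.
  - by move=> w _; rewrite lee_fin exprn_ge0.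
  - exact/measurable_EFinP/measurable_funX.
  rewrite -ge0_integralD//.
  - by move=> w _; rewrite lee_fin exprn_ge0.
  - exact/measurable_EFinP/measurable_funX.
  - by move=> w _; rewrite -EFinM lee_fin mulr_ge0// exprn_ge0.
  - by apply: emeasurable_funM => //; exact/measurable_EFinP/measurable_funX.
rewrite (ge0_integral_indep_of (@mH n) (@mXf n) (@indX n) (@mY n) mg); last first.
  move=> w x; have h : 0 <= Num.max 0 (Y n w - x) by rewrite le_max lexx.
  by apply: addr_ge0; [|apply: mulr_ge0 => //]; exact: exprn_ge0.
by apply: eq_integral => w _; rewrite EX.
Qed.

(** Induction on [n] for all orders at once: by [EWS], order [m] of [W n.+1] is controlled by order
    [m.+1] of [Y n], which by [EY] only involves moments of [W n] and [V n]. *)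
Let EW_fin n m : EW n m \is a fin_num.
Proof.
elim: n m => [|n IH] m.
  rewrite /EW (_ : (fun w => _) = cst (0 ^+ m)%:E)//.
  by rewrite integral_cst//= probability_setT mule1.
have EYfin k : (\int[P]_w (Y n w ^+ k)%:E < +oo)%E.
  rewrite EY ltey_eq; apply/orP; left; apply/sum_fin_numP => i _ _.
  by rewrite !fin_numM.
case: m => [|m].
  rewrite /EW (_ : (fun w => _) = cst 1%:E)//.
  by rewrite integral_cst//= probability_setT mule1.
rewrite ge0_fin_numE//.
have c0 : 0 < m.+2%:R / lam by rewrite divr_gt0.
have := EYfin m.+2; rewrite -EWS.
case: (EW n.+1 m.+1) (EW_ge0 n.+1 m.+1) => [r||]// _.
  by rewrite ltry.
by rewrite gt0_muley ?lte_fin// addey// -ltNye (lt_le_trans _ (EW_ge0 _ _)).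
Qed.

Let a n m := fine (EW n m).
Let EaE n m : EW n m = (a n m)%:E. Proof. by rewrite fineK. Qed.

Let a_cesaro m : exists2 C, 0 <= C & forall K, \sum_(0 <= n < K) a n m <= C * K%:R.
Proof.
have B0 i : 0 <= B i.
  by rewrite -lee_fin; exact: le_trans (EV_ge0 0 i) (EVB 0 i).
(* The binomial terms of degree 0 and 1 in [V] are the leading ones of the recursion; the others,
   hence the shift by two, are bounded uniformly in [n] through [B]. *)
apply: (@cesaro_moments_bounded _ a (fun m i => 'C(m.+2, i.+2)%:R * B i.+2) lam v1) => //.
- by move=> n k; rewrite -lee_fin -EaE.
- move=> n; rewrite /a /EW (_ : (fun w => _) = cst 1%:E)//.
  by rewrite integral_cst//= probability_setT mule1.
- move=> k; rewrite /a /EW (_ : (fun w => _) = cst 0%:E) ?integral0//.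
  by apply/funext => w; rewrite /W/= expr0n.
- by move=> k i; rewrite mulr_ge0.
move=> n k; pose c i := fine (\int[P]_w (V n w ^+ i)%:E)%E.
have cE i : (\int[P]_w (V n w ^+ i)%:E)%E = (c i)%:E by rewrite fineK.
have c0 : c 0%N = 1.
  apply: EFin_inj; rewrite -cE; under eq_integral do rewrite expr0.
  by rewrite integral_cst//= probability_setT mule1.
have c1 : c 1%N = v1.
  by apply: EFin_inj; rewrite -cE; under eq_integral do rewrite expr1.
have cB i : c i <= B i by rewrite -lee_fin -cE.
have -> : a n.+1 k.+2 + k.+2%:R / lam * a n.+1 k.+1 =
    \sum_(i < k.+3) a n (k.+2 - i)%N * ('C(k.+2, i)%:R * c i).
  apply: EFin_inj; rewrite EFinD EFinM -!EaE EWS EY -sumEFin.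
  by apply: eq_bigr => i _; rewrite EaE cE !EFinM.
rewrite big_ord_recl big_ord_recl/= (_ : bump 0 0 = 1)%N//.
rewrite subn0 bin0 bin1 subn1/= c0 c1 !mulr1 addrA.
apply: lerD; first by rewrite lerD2l mulrC.
apply: ler_sum => i _; rewrite /bump/= !add1n !subSS.
apply: ler_wpM2l; first by rewrite -lee_fin -EaE.
exact: ler_wpM2l.
Qed.

Let integrable_affine (f : Omega -> R) (r al be : R) :
  P.-integrable setT (EFin \o f) -> (\int[P]_w (f w)%:E = r%:E)%E ->
  P.-integrable setT (fun w => (al * f w + be)%:E) /\
  (\int[P]_w (al * f w + be)%:E = (al * r + be)%:E)%E.
Proof.
move=> f1 fr.
have c1 : P.-integrable setT (cst be%:E) by exact: finite_measure_integrable_cst.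
have f2 : P.-integrable setT (fun w => al%:E * (f w)%:E)%E by exact: integrableZl.
have E : (fun w => (al * f w + be)%:E) = (fun w => al%:E * (f w)%:E + cst be%:E w)%E.
  by apply/funext => w; rewrite EFinD EFinM.
rewrite E; split; first exact: integrableD.
by rewrite integralD// integralZl// fr integral_cst//= probability_setT mule1.
Qed.

Let ge0_integrable (f : Omega -> R) r : measurable_fun setT f ->
  (forall w, 0 <= f w) -> (\int[P]_w (f w)%:E <= r%:E)%E ->
  P.-integrable setT (EFin \o f).
Proof.
move=> mf f0 fr; apply/integrableP; split; first exact/measurable_EFinP.
under eq_integral do rewrite /= ger0_norm//.
exact: le_lt_trans fr (ltry _).
Qed.

Let iV n m : P.-integrable setT (fun w => (V n w ^+ m)%:E).
Proof.
apply: (@ge0_integrable (fun w => V n w ^+ m)) (EVB n m).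
  exact: measurable_funX.
by move=> w; rewrite exprn_ge0.
Qed.

(** One dominating function for the squares of all four increments below. Fourth powers are needed
    because [D1] and [D2] are quadratic; the 1 absorbs constants and second powers. *)
Let Q n w := 1 + W n w ^+ 4 + V n w ^+ 4 + W n.+1 w ^+ 4.

Let Q_dom n w : [/\ 1 <= Q n w, W n w ^+ 2 <= Q n w & W n.+1 w ^+ 2 <= Q n w] /\
  [/\ V n w ^+ 2 <= Q n w, W n w ^+ 4 + V n w ^+ 4 <= Q n w &
      W n.+1 w ^+ 4 <= Q n w].
Proof.
rewrite /Q !(exprM _ 2 2).
move: (W n w ^+ 2) (W n.+1 w ^+ 2) (V n w ^+ 2) => x y z.
by split; split; nra.
Qed.

Let mQ n : measurable_fun setT (Q n).
Proof.
by do 3 (apply: measurable_funD; last exact: measurable_funX).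
Qed.

Let EQ n : (\int[P]_w (Q n w)%:E <= (1 + a n 4 + B 4 + a n.+1 4)%:E)%E.
Proof.
have m4 (f : Omega -> R) : measurable_fun setT f ->
    measurable_fun setT (fun w => (f w ^+ 4)%:E).
  by move=> mf; exact/measurable_EFinP/measurable_funX.
have p4 (f : Omega -> R) : (forall w, 0 <= f w) ->
    forall w, setT w -> (0 <= (f w ^+ 4)%:E)%E.
  by move=> f0 w _; rewrite lee_fin exprn_ge0.
have E : (fun w => (Q n w)%:E) = (fun w => (cst 1%:E w + (W n w ^+ 4)%:E) +
    ((V n w ^+ 4)%:E + (W n.+1 w ^+ 4)%:E))%E.
  by apply/funext => w; rewrite /= -!EFinD /Q; congr EFin; ring.
rewrite E ge0_integralD//; last 4 first.
- by move=> w _; rewrite adde_ge0// p4.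
- by apply: emeasurable_funD => //; exact: m4.
- by move=> w _; rewrite adde_ge0// p4.
- by apply: emeasurable_funD => //; exact: m4.
rewrite ge0_integralD//; [|exact: p4|exact: m4].
rewrite ge0_integralD//; [|exact: p4|exact: m4|exact: p4|exact: m4].
rewrite integral_cst//= probability_setT mule1.
have -> : (1 + a n 4 + B 4 + a n.+1 4)%:E =
    ((1%:E + (a n 4)%:E) + ((B 4)%:E + (a n.+1 4)%:E))%E.
  by rewrite -!EFinD; congr EFin; ring.
apply: leeD; first by rewrite -(EaE n 4).
by apply: leeD; [exact: EVB|rewrite -(EaE n.+1 4)].
Qed.

Let dominated_by_Q : exists c, forall (k : R) (D : nat -> Omega -> R), 0 <= k ->
  (forall n, measurable_fun setT (D n)) ->
  (forall n w, D n w ^+ 2 <= k * Q n w) ->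
  (forall n, P.-integrable setT (fun w => (D n w ^+ 2)%:E)) /\
  forall K, (\sum_(0 <= n < K) \int[P]_w (D n w ^+ 2)%:E <= (k * c * K%:R)%:E)%E.
Proof.
have [C C0 HC] := a_cesaro 4.
(* The last [C * 2] pays for the shifted terms: the sum of [a n.+1 4] over [n < K] is at most
   [C * (K + 1)], hence at most [C * 2 * K] once [K > 0]. *)
exists (1 + C + B 4 + C * 2) => k D k0 mD DQ.
have DE n : (\int[P]_w (D n w ^+ 2)%:E <=
    (k * (1 + a n 4 + B 4 + a n.+1 4))%:E)%E.
  apply: (@le_trans _ _ (\int[P]_w (k%:E * (Q n w)%:E))%E).
    apply: ge0_le_integral => //.
    - by move=> w _; rewrite lee_fin sqr_ge0.
    - exact/measurable_EFinP/measurable_funX.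
    - by apply: emeasurable_funM => //; exact/measurable_EFinP.
    - by move=> w _; rewrite -EFinM lee_fin.
  rewrite ge0_integralZl_EFin//; last 2 first.
  - by move=> w _; rewrite lee_fin; have [[+ _ _] _] := Q_dom n w; apply: le_trans.
  - exact/measurable_EFinP.
  by rewrite EFinM lee_wpmul2l// lee_fin.
split.
  move=> n; apply: (@ge0_integrable (fun w => D n w ^+ 2)) (DE n).
    exact: measurable_funX.
  by move=> w; rewrite sqr_ge0.
move=> K.
apply: (@le_trans _ _ (\sum_(0 <= n < K) (k * (1 + a n 4 + B 4 + a n.+1 4))%:E)%E).
  exact: lee_sum.
rewrite sumEFin lee_fin -mulr_sumr -mulrA ler_wpM2l//.
rewrite !big_split/= !sumr_const_nat subn0 -[B 4 *+ K]mulr_natr.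
rewrite !mulrDl mul1r; apply: lerD; first by rewrite lerD2r lerD2l.
case: K => [|K]; first by rewrite big_nil mulr0.
have a04 : 0 <= a 0 4 by rewrite -lee_fin -EaE.
have h := HC K.+2; rewrite big_nat_recl// in h.
apply: (@le_trans _ _ (C * K.+2%:R)); first by move: h a04; lra.
rewrite -mulrA ler_wpM2l// -natrM ler_nat; lia.
Qed.

Let avg (u : nat -> R) (K : nat) := K%:R^-1 * \sum_(0 <= n < K) u n.

(** [D1] is the noise of the interarrival time; [D2], [D3], [D4] are noises of the service. [D2] is
    [Y n ^+ 2] minus its mean over [V n] with [W n] frozen, so [Y] cancels in [D1 + D2]. *)
Let D1 n w := W n.+1 w ^+ 2 + 2 / lam * W n.+1 w - Y n w ^+ 2.
Let D2 n w := 2 * W n w * V n w - 2 * W n w * v1 + (V n w ^+ 2 - v2).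
Let D3 n w := V n w - v1.
Let D4 n w := ((0 < V n w)%R%:R - p) * W n w.

Let iV1 n : P.-integrable setT (EFin \o V n).
Proof. by have := iV n 1; under eq_fun do rewrite expr1. Qed.

Let D1_slln : {ae P, forall w,
  (fun k => avg (D1 ^~ w) (k.+1 ^ 2)) @ \oo --> 0}.
Proof.
have [c Hc] := dominated_by_Q.
have mD n : measurable_fun setT (D1 n).
  apply: measurable_funB; last exact: measurable_funX.
  by apply: measurable_funD; [exact: measurable_funX|exact: measurable_funM].
(* The square of a sum of three terms is at most 3 times the sum of the squares: [3] for
   [W n.+1 ^+ 4], [12 / lam^2 = 3 (2 / lam)^2], and [24] from [(u + v)^4 <= 8 (u^4 + v^4)]; finally
   [3 + 24 = 27]. *)
have k0 : 0 <= 27 + 12 / lam ^+ 2.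
  by rewrite addr_ge0// divr_ge0// sqr_ge0.
have [||Di Dc] := Hc _ D1 k0.
- by [].
- move=> n w; have [[q1 q2 q3] [q4 q5 q6]] := Q_dom n w.
  have : D1 n w ^+ 2 <= 3 * (W n.+1 w ^+ 4) + 12 / lam ^+ 2 * W n.+1 w ^+ 2 +
      24 * (W n w ^+ 4 + V n w ^+ 4).
    have -> : 12 / lam ^+ 2 * W n.+1 w ^+ 2 = 3 * (2 / lam * W n.+1 w) ^+ 2.
      by field; rewrite gt_eqF.
    rewrite /D1 /Y; move: (2 / lam * W n.+1 w) => x.
    have -> : W n.+1 w ^+ 4 = (W n.+1 w ^+ 2) ^+ 2 by rewrite -exprM.
    move: (W n.+1 w ^+ 2) (W n w) (V n w) => y u v.
    have h1 (b f e : R) : (b + f - e) ^+ 2 <= 3 * b ^+ 2 + 3 * f ^+ 2 + 3 * e ^+ 2.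
      have := mulr_sqr_le b f; have := mulr_sqr_le b (- e).
      have := mulr_sqr_le f (- e); rewrite sqrrN.
      rewrite (_ : (b + f - e) ^+ 2 = b ^+ 2 + f ^+ 2 + e ^+ 2 + 2 * (b * f) +
        2 * (b * - e) + 2 * (f * - e)); last by ring.
      by lra.
    have h2 : (u + v) ^+ 2 <= 2 * (u ^+ 2 + v ^+ 2).
      by rewrite mulrDr; exact: sqrrD_le.
    have h3 : ((u + v) ^+ 2) ^+ 2 <= (2 * (u ^+ 2 + v ^+ 2)) ^+ 2.
      by rewrite ler_pXn2r// nnegrE ?sqr_ge0// mulr_ge0// addr_ge0// sqr_ge0.
    have -> : u ^+ 4 = (u ^+ 2) ^+ 2 by rewrite -exprM.
    have -> : v ^+ 4 = (v ^+ 2) ^+ 2 by rewrite -exprM.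
    have := h1 y x ((u + v) ^+ 2).
    move: (u ^+ 2) (v ^+ 2) h3 => u2 v2'.
    have h4 : (2 * (u2 + v2')) ^+ 2 <= 8 * (u2 ^+ 2 + v2' ^+ 2).
      by have := sqrrD_le u2 v2'; rewrite exprMn; lra.
    by move: h4; lra.
  have : 12 / lam ^+ 2 * W n.+1 w ^+ 2 <= 12 / lam ^+ 2 * Q n w.
    by rewrite ler_wpM2l// divr_ge0// sqr_ge0.
  by rewrite mulrDl; lra.
pose g (z : R * R) := Num.max 0 (z.1 - z.2) ^+ 2 +
  2 / lam * Num.max 0 (z.1 - z.2) - z.1 ^+ 2.
have mm : measurable_fun setT (fun z : R * R => Num.max 0 (z.1 - z.2)).
  by apply: measurable_maxr => //; exact: measurable_funB.
have mg : measurable_fun setT g.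
  apply: measurable_funB; last exact: measurable_funX.
  by apply: measurable_funD; [exact: measurable_funX|exact: measurable_funM].
have gaff n w : P.-integrable setT (fun w' => (g (Y n w, X n w'))%:E) /\
    (\int[P]_w' (g (Y n w, X n w'))%:E = 0)%E.
  have mX' : measurable_fun setT (fun w' => Num.max 0 (Y n w - X n w')).
    by apply: measurable_maxr => //; exact: measurable_funB.
  have E := EX n 0 (Y0 n w).
  have [||i1 i2] := @integrable_affine (fun w' => Num.max 0 (Y n w - X n w') ^+ 2 +
    2 / lam * Num.max 0 (Y n w - X n w') ^+ 1) (Y n w ^+ 2) 1 (- Y n w ^+ 2).
  - apply: (ge0_integrable (r := Y n w ^+ 2)); last by rewrite E.
      apply: measurable_funD; first exact: measurable_funX.
      by apply: measurable_funM => //; exact: measurable_funX.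
    move=> w'; have h : 0 <= Num.max 0 (Y n w - X n w') by rewrite le_max lexx.
    by rewrite addr_ge0 ?sqr_ge0// mulr_ge0 ?divr_ge0// ltW.
  - exact: E.
  split; first by under eq_fun do rewrite /g/= -[X in 2 / lam * X]expr1 -[X in X - _]mul1r.
  under eq_integral do rewrite /g/= -[X in 2 / lam * X]expr1 -[X in X - _]mul1r.
  by rewrite i2 mul1r subrr.
have HH n : <<s H n >> `<=` <<s H n.+1 >>.
  exact: subset_trans (@HG n) (@GH n.+1).
apply: (@innovation_slln_sqr _ _ _ P H X Y g _) => //.
- by move=> n; exact: measurable_wrtS (@GH n.+1) (@mX n).
- by move=> n w; exact: (gaff n w).1.
- by move=> n w; exact: (gaff n w).2.
Qed.

Let V_slln (g : R * R -> R) (k : R) : 0 <= k -> measurable_fun setT g ->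
  (forall n w, g (W n w, V n w) ^+ 2 <= k * Q n w) ->
  (forall n w, P.-integrable setT (fun w' => (g (W n w, V n w'))%:E) /\
    (\int[P]_w' (g (W n w, V n w'))%:E = 0)%E) ->
  {ae P, forall w,
    (fun k => avg (fun n => g (W n w, V n w)) (k.+1 ^ 2)) @ \oo --> 0}.
Proof.
move=> k0 mg gQ gaff; have [c Hc] := dominated_by_Q.
have [|Di Dc] := Hc _ (fun n w => g (W n w, V n w)) k0 _ gQ.
  by move=> n; apply: (measurableT_comp mg); exact: measurable_fun_pair.
apply: (@innovation_slln_sqr _ _ _ P G V W g _) => //.
- by move=> n; exact: subset_trans (@GH n) (@HG n).
- by move=> n; exact: measurable_wrtS (@HG n) (@mV n).
- by move=> n w; exact: (gaff n w).1.
- by move=> n w; exact: (gaff n w).2.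
Qed.

Let D2_slln : {ae P, forall w,
  (fun k => avg (D2 ^~ w) (k.+1 ^ 2)) @ \oo --> 0}.
Proof.
apply: (@V_slln (fun z => 2 * z.1 * z.2 - 2 * z.1 * v1 + (z.2 ^+ 2 - v2))
  (20 + 16 * v1 ^+ 2 + 4 * v2 ^+ 2)).
- by apply: addr_ge0; [apply: addr_ge0 => //|]; apply: mulr_ge0 => //; exact: sqr_ge0.
- apply: measurable_funD; last first.
    by apply: measurable_funB => //; exact: measurable_funX.
  by apply: measurable_funB; do ?apply: measurable_funM.
- move=> n w /=; have [[q1 q2 q3] [q4 q5 q6]] := Q_dom n w.
  have h : (2 * W n w * V n w - 2 * W n w * v1 + (V n w ^+ 2 - v2)) ^+ 2 <=
      8 * W n w ^+ 4 + 12 * V n w ^+ 4 + 16 * v1 ^+ 2 * W n w ^+ 2 + 4 * v2 ^+ 2.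
    have -> : W n w ^+ 4 = (W n w ^+ 2) ^+ 2 by rewrite -exprM.
    have -> : V n w ^+ 4 = (V n w ^+ 2) ^+ 2 by rewrite -exprM.
    move: (W n w) (V n w) => x y.
    have := sqrrD_le (2 * x * y - 2 * x * v1) (y ^+ 2 - v2).
    have := sqrrB_le (2 * x * y) (2 * x * v1).
    have := sqrrB_le (y ^+ 2) v2.
    have h3 := mulr_sqr_le (x ^+ 2) (y ^+ 2).
    have -> : (2 * x * y) ^+ 2 = 4 * (x ^+ 2 * y ^+ 2) by ring.
    have -> : (2 * x * v1) ^+ 2 = 4 * (v1 ^+ 2 * x ^+ 2) by ring.
    by move: h3; lra.
  have h1 : 16 * v1 ^+ 2 * W n w ^+ 2 <= 16 * v1 ^+ 2 * Q n w.
    by rewrite ler_wpM2l// mulr_ge0// sqr_ge0.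
  have h2 : 4 * v2 ^+ 2 <= 4 * v2 ^+ 2 * Q n w.
    by rewrite ler_peMr// mulr_ge0// sqr_ge0.
  have h3 : 0 <= W n w ^+ 4 by rewrite exprn_ge0.
  have h4 : 0 <= V n w ^+ 4 by rewrite exprn_ge0.
  by rewrite !mulrDl; lra.
move=> n w.
have [i1 e1] := integrable_affine (2 * W n w) (- (2 * W n w * v1)) (iV1 n) (EV1 n).
have [i2 e2] := integrable_affine 1 (- v2) (iV n 2) (EV2 n).
have E : (fun w' => (2 * W n w * V n w' - 2 * W n w * v1 + (V n w' ^+ 2 - v2))%:E) =
   (fun w' => (2 * W n w * V n w' - 2 * W n w * v1)%:E +
              (1 * V n w' ^+ 2 - v2)%:E)%E.
  by apply/funext => w'; rewrite -EFinD mul1r.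
rewrite /= E; split; first exact: integrableD.
by rewrite integralD// e1 e2 mul1r !subrr adde0.
Qed.

Let D3_slln : {ae P, forall w,
  (fun k => avg (D3 ^~ w) (k.+1 ^ 2)) @ \oo --> 0}.
Proof.
apply: (@V_slln (fun z => z.2 - v1) (2 + 2 * v1 ^+ 2)).
- by apply: addr_ge0 => //; apply: mulr_ge0 => //; exact: sqr_ge0.
- exact: measurable_funB.
- move=> n w /=; have [[q1 q2 q3] [q4 q5 q6]] := Q_dom n w.
  have h1 := sqrrB_le (V n w) v1.
  have h2 : 2 * v1 ^+ 2 <= 2 * v1 ^+ 2 * Q n w.
    by rewrite ler_peMr// mulr_ge0// sqr_ge0.
  by rewrite mulrDl; lra.
move=> n w; have [i1 e1] := integrable_affine 1 (- v1) (iV1 n) (EV1 n).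
split; first by under eq_fun do rewrite /= -[X in X - _]mul1r.
by under eq_integral do rewrite /= -[X in X - _]mul1r; rewrite e1 mul1r subrr.
Qed.

Let D4_slln : {ae P, forall w,
  (fun k => avg (D4 ^~ w) (k.+1 ^ 2)) @ \oo --> 0}.
Proof.
have mb : measurable_fun setT (fun z : R * R => ((0 < z.2)%R%:R : R)).
  rewrite (_ : (fun _ => _) = \1_[set z : R * R | 0 < z.2]).
    apply: measurable_indic.
    have : measurable_fun setT (fun z : R * R => 0 < z.2).
      exact: measurable_fun_ltr.
    by move=> /(_ measurableT [set true]); rewrite setTI; exact.
  by apply/funext => z; rewrite indicE; congr (_%:R); congr nat_of_bool;
    apply/idP/idP; rewrite inE.
apply: (@V_slln (fun z => ((0 < z.2)%R%:R - p) * z.1) (2 + 2 * p ^+ 2)).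
- by apply: addr_ge0 => //; apply: mulr_ge0 => //; exact: sqr_ge0.
- by apply: measurable_funM => //; exact: measurable_funB.
- move=> n w /=; have [[q1 q2 q3] [q4 q5 q6]] := Q_dom n w.
  rewrite exprMn; apply: ler_pM; rewrite ?sqr_ge0//.
  have := sqrrB_le (0 < V n w)%R%:R p; case: (0 < V n w); rewrite /= ?expr1n ?expr0n/=; lra.
move=> n w.
have mV0 : measurable [set w' | 0 < V n w'].
  have : measurable_fun setT (fun w' => 0 < V n w') by exact: measurable_fun_ltr.
  by move=> /(_ measurableT [set true]); rewrite setTI; exact.
have Ei : (\int[P]_w' (\1_[set w' | 0 < V n w'] w')%:E = p%:E)%E.
  by rewrite integral_indic// setIT; exact: Vp.
have [|i1 e1] := integrable_affine (W n w) (- (p * W n w)) _ Ei.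
  by apply: (ge0_integrable (r := p)) => //; rewrite Ei.
have E : (fun w' => (((0 < V n w')%R%:R - p) * W n w)%:E) =
    (fun w' => (W n w * \1_[set w' | 0 < V n w'] w' + - (p * W n w))%:E).
  apply/funext => w'; rewrite mulrBl [_%:R * _]mulrC indicE.
  by congr (_ * _%:R - _)%:E; congr nat_of_bool; apply/idP/idP; rewrite inE.
by rewrite /= E; split => //; rewrite e1 mulrC subrr.
Qed.

(** This removes the boundary term of the telescoped sum. The Cesaro bound only gives a fourth
    moment of [W n] of order [n], which suffices: at [n = (k+1)^2] the squared quantity has mean of
    order [1 / (k+1)^2], a summable sequence. *)
Let W2_cvg : {ae P, forall w,
  (fun k => ((k.+1 ^ 2)%:R)^-1 * W (k.+1 ^ 2) w ^+ 2) @ \oo --> 0}.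
Proof.
have [C C0 HC] := a_cesaro 4.
have a0 n m : 0 <= a n m by rewrite -lee_fin -EaE.
have aC n : a n 4 <= C * n.+1%:R.
  apply: le_trans (HC n.+1); rewrite big_nat_recr//= lerDr.
  by apply: sumr_ge0.
have := @ge0_ae_cvg_series _ _ _ P
  (fun k w => (((k.+1 ^ 2)%:R)^-1 * W (k.+1 ^ 2) w ^+ 2) ^+ 2) (C * 2 * 2) _ _ _.
case=> [n|n w|K|A [mA PA0 sA]].
- by apply: measurable_funX; apply: measurable_funM => //; exact: measurable_funX.
- exact: sqr_ge0.
- apply: (@le_trans _ _ (\sum_(0 <= k < K) (C * 2 * (k.+1%:R ^+ 2)^-1)%:E)%E).
    apply: lee_sum => k _; under eq_integral do rewrite exprMn -exprM EFinM.
    rewrite ge0_integralZl_EFin ?sqr_ge0//; last 2 first.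
    - by move=> w _; rewrite lee_fin exprn_ge0.
    - exact/measurable_EFinP/measurable_funX.
    rewrite [X in (_ * X)%E](EaE (k.+1 ^ 2) 4) -EFinM lee_fin natrX.
    apply: (@le_trans _ _ ((k.+1%:R ^+ 2)^-1 ^+ 2 * (C * 2 * k.+1%:R ^+ 2))).
      rewrite ler_wpM2l ?sqr_ge0//; apply: (le_trans (aC _)).
      by rewrite -mulrA ler_wpM2l// -natrX -natrM ler_nat; lia.
    rewrite le_eqVlt; apply/orP; left; apply/eqP.
    have : k.+1%:R != 0 :> R by rewrite pnatr_eq0.
    by move: (k.+1%:R) => b b0; field.
  by rewrite sumEFin lee_fin -mulr_sumr ler_wpM2l ?mulr_ge0// sum_inv_sqr_le2.
by exists A; split => // w Hw; apply: sA => /= Hc; apply: Hw; exact: cvg_sqr0.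
Qed.

(** The first limit is the Pollaczek-Khinchine mean sojourn time and serves the upper bound. The
    second counts only waits of customers with positive service; the factor [p] appears because the
    indicator of [0 < V m] is independent of the wait. It serves the lower bound. *)
Theorem lindley_cesaro : {ae P, forall w,
  (fun n => n.+1%:R^-1 * \sum_(0 <= m < n.+1)
     (lindley (V ^~ w) (X ^~ w) m + V m w)) @ \oo -->
    lam * v2 / (2 * (1 - lam * v1)) + v1 /\
  (fun n => n.+1%:R^-1 * \sum_(0 <= m < n.+1)
     ((0 < V m w)%R%:R * lindley (V ^~ w) (X ^~ w) m + V m w)) @ \oo -->
    p * (lam * v2 / (2 * (1 - lam * v1))) + v1}.
Proof.
apply: filterS (filterI D1_slln (filterI D2_slln (filterI D3_slln
  (filterI D4_slln W2_cvg)))) => w [h1 [h2 [h3 [h4 h5]]]].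
have K0 k : (k.+1 ^ 2)%:R != 0 :> R by rewrite pnatr_eq0 expn_eq0.
have avgD (u u' : nat -> R) k : avg u k + avg u' k = avg (fun n => u n + u' n) k.
  by rewrite /avg big_split/= mulrDr.
have avgC (b : R) k : avg (fun=> b) (k.+1 ^ 2) = b.
  by rewrite /avg sumr_const_nat subn0 -[b *+ _]mulr_natl mulKf.
(* Here [W 0 = 0] is used, and [2 / lam * W K w] is the price of shifting the index from [W n.+1] to
   [W n]. *)
have tel K : \sum_(0 <= n < K) D1 n w + \sum_(0 <= n < K) D2 n w =
    W K w ^+ 2 + 2 / lam * W K w + 2 * (lam^-1 - v1) * \sum_(0 <= n < K) W n w -
    v2 * K%:R.
  elim: K => [|K IH].
    by rewrite !big_nil /W/= expr0n/= !mulr0 !addr0 subr0.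
  rewrite !big_nat_recr//=.
  rewrite (_ : \sum_(0 <= i < K) D1 i w + D1 K w + (\sum_(0 <= i < K) D2 i w + D2 K w) =
    (\sum_(0 <= i < K) D1 i w + \sum_(0 <= i < K) D2 i w) + (D1 K w + D2 K w)); last by ring.
  by rewrite IH /D1 /D2 /Y -natr1; field; rewrite gt_eqF.
have r0 : 1 - lam * v1 != 0 by rewrite subr_eq0 gt_eqF.
(* The boundary term linear in [W] follows from the quadratic one, since [(W / K)^2 <= W^2 / K] for
   [K >= 1]. *)
have h6 : (fun k => ((k.+1 ^ 2)%:R)^-1 * W (k.+1 ^ 2) w) @ \oo --> 0.
  apply: cvg_sqr0.
  apply: (@squeeze_cvgr _ _ _ _ (cst 0) (fun k => ((k.+1 ^ 2)%:R)^-1 * W (k.+1 ^ 2) w ^+ 2)) => //.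
    apply: nearW => k; rewrite sqr_ge0/= exprMn ler_wpM2r ?sqr_ge0// expr2.
    by rewrite ler_piMr// invf_le1// ler1n expn_gt0.
  exact: cvg_cst.
set wb := lam * v2 / _.
have hW : (fun k => avg (W ^~ w) (k.+1 ^ 2)) @ \oo --> wb.
  have -> : (fun k => avg (W ^~ w) (k.+1 ^ 2)) = (fun k =>
      (avg (D1 ^~ w) (k.+1 ^ 2) + avg (D2 ^~ w) (k.+1 ^ 2) + v2 -
       (((k.+1 ^ 2)%:R)^-1 * W (k.+1 ^ 2) w ^+ 2 +
        2 / lam * (((k.+1 ^ 2)%:R)^-1 * W (k.+1 ^ 2) w))) *
      (lam / (2 * (1 - lam * v1)))).
    apply/funext => k; rewrite /avg -mulrDr tel.
    move: (K0 k); move: ((k.+1 ^ 2)%:R : R) => K Kn0.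
    by field; rewrite Kn0 r0 gt_eqF.
  have -> : wb = (0 + 0 + v2 - (0 + 2 / lam * 0)) * (lam / (2 * (1 - lam * v1))).
    by rewrite /wb mulr0 !addr0 !add0r subr0 mulrCA mulrA.
  apply: cvgM; last exact: cvg_cst.
  apply: cvgB; first by apply: cvgD; [exact: cvgD|exact: cvg_cst].
  by apply: cvgD => //; apply: cvgM => //; exact: cvg_cst.
have hV : (fun k => avg (V ^~ w) (k.+1 ^ 2)) @ \oo --> v1.
  have -> : (fun k => avg (V ^~ w) (k.+1 ^ 2)) =
      (fun k => avg (D3 ^~ w) (k.+1 ^ 2) + v1).
    apply/funext => k; rewrite -[X in _ = _ + X](avgC v1 k) avgD; congr (avg _ _).
    by apply/funext => n; rewrite /D3 subrK.
  by rewrite -[X in _ --> X]add0r; apply: cvgD => //; exact: cvg_cst.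
have hI : (fun k => avg (fun n => (0 < V n w)%R%:R * W n w) (k.+1 ^ 2)) @ \oo
    --> p * wb.
  have -> : (fun k => avg (fun n => (0 < V n w)%R%:R * W n w) (k.+1 ^ 2)) =
      (fun k => avg (D4 ^~ w) (k.+1 ^ 2) + p * avg (W ^~ w) (k.+1 ^ 2)).
    apply/funext => k.
    rewrite (_ : p * avg _ _ = avg (fun n => p * W n w) (k.+1 ^ 2)); last first.
      by rewrite /avg mulrCA mulr_sumr.
    by rewrite avgD; congr (avg _ _); apply/funext => n; rewrite /D4; ring.
  rewrite -[X in _ --> X]add0r; apply: cvgD => //.
  by apply: cvgM => //; exact: cvg_cst.
split; apply: cesaro_cvg_sqr.
- by move=> n; rewrite addr_ge0// lindley_ge0.
- change ((fun k => avg (fun n => W n w + V n w) (k.+1 ^ 2)) @ \oo --> wb + v1).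
  by under eq_fun do rewrite -avgD; exact: cvgD.
- by move=> n; rewrite addr_ge0// mulr_ge0// lindley_ge0.
- change ((fun k => avg (fun n => (0 < V n w)%R%:R * W n w + V n w) (k.+1 ^ 2))
    @ \oo --> p * wb + v1).
  by under eq_fun do rewrite -avgD; exact: cvgD.
Qed.

End lindley_slln.

(** * Exponential and beta integrals *)

Section exponential_law.
Context d (Omega : measurableType d) (R : realType) (P : probability Omega R).
Local Notation leb := (@lebesgue_measure R).

(** The law of [X] is given only through probabilities of Borel sets, so the left side is first
    written as an integral of tails. Tonelli on the region [0 <= r < g x] then restores the
    density. *)
Lemma ge0_integral_exponential (lam : R) (X : Omega -> R) (g : R -> R) :
  0 < lam -> measurable_fun setT X ->
  (forall A, measurable A -> P (X @^-1` A) = exponential_prob lam A) ->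
  measurable_fun setT g -> (forall x, 0 <= g x) ->
  (\int[P]_w (g (X w))%:E = \int[leb]_x (g x * exponential_pdf lam x)%:E)%E.
Proof.
move=> lam0 mX hX mg g0.
have mgX : measurable_fun setT (g \o X) by exact: measurableT_comp.
have pdf0 x : 0 <= exponential_pdf lam x by exact: exponential_pdf_ge0 (ltW lam0) x.
have mpdf : measurable_fun setT (exponential_pdf lam).
  exact: measurable_exponential_pdf.
pose Y : {RV P >-> R} := mfun_Sub (mem_set mgX).
have Y0 w : 0 <= Y w by exact: g0.
have := ge0_expectation_ccdf Y0; rewrite expectation_def => ->.
pose h (z : measurableTypeR R * measurableTypeR R) : \bar R :=
  (\1_[set z : R * R | 0 <= z.1 < g z.2] z * exponential_pdf lam z.2)%:E.
have mset : measurable [set z : R * R | 0 <= z.1 < g z.2].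
  have m1 : measurable_fun setT (fun z : R * R => 0 <= z.1).
    exact: measurable_fun_ler.
  have m2 : measurable_fun setT (fun z : R * R => z.1 < g z.2).
    by apply: measurable_fun_ltr => //; exact: measurableT_comp.
  rewrite (_ : [set _ | _] = (fun z : R * R => 0 <= z.1) @^-1` [set true] `&`
     (fun z : R * R => z.1 < g z.2) @^-1` [set true]); last first.
    by apply/seteqP; split => z /=; [move=> /andP[]|move=> [-> ->]].
  by apply: measurableI; rewrite -[X in measurable X]setTI; [exact: m1|exact: m2].
have mh : measurable_fun setT h.
  apply/measurable_EFinP; apply: measurable_funM; first exact: measurable_indic.
  exact: measurableT_comp.
have h0 z : (0 <= h z)%E by rewrite lee_fin mulr_ge0.
transitivity (\int[leb]_r \int[leb]_x h (r, x))%E.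
  rewrite integral_mkcond; apply: eq_integral => r _.
  rewrite patchE; case: ifPn => [|/negP rN].
    rewrite inE/= in_itv/= andbT => r0.
    have mA : measurable (g @^-1` `]r, +oo[).
      by rewrite -[X in measurable X]setTI; apply: mg => //; exact: measurable_itv.
    transitivity (exponential_prob lam (g @^-1` `]r, +oo[)); first exact: hX.
    rewrite /exponential_prob integral_mkcond; apply: eq_integral => x _.
    rewrite patchE /h indicE; case: ifPn => [|/negP xN].
      rewrite inE/= in_itv/= andbT => rg.
      by rewrite mem_set ?mul1r//= r0.
    rewrite memNset ?mul0r//= => /andP[_ rg]; apply: xN.
    by rewrite inE/= in_itv/= andbT.
  apply/esym/integral0_eq => x _; rewrite /h indicE memNset ?mul0r//=.
  by move=> /andP[r0 _]; apply: rN; rewrite inE/= in_itv/= andbT.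
rewrite (@fubini_tonelli _ _ _ _ _ leb leb h)//.
apply: eq_integral => x _ /=.
have Eh r : h (r, x) =
    ((exponential_pdf lam x)%:E * (\1_[set` `[0, g x[] r)%:E)%E.
  rewrite /h/= mulrC EFinM !indicE.
  have [rg|/negP rg] := boolP (0 <= r < g x).
    by rewrite !mem_set//= in_itv.
  by rewrite !memNset//= in_itv.
under eq_integral do rewrite Eh.
rewrite ge0_integralZl_EFin//; last exact/measurable_EFinP/measurable_indic.
rewrite mulrC EFinM; congr (_ * _)%E.
rewrite integral_indic//= setIT lebesgue_measure_itv/= lte_fin sube0.
by case: ltgtP (g0 x) => // <-.
Qed.

Lemma exponential_lindley_moment (lam : R) (X : Omega -> R) (m : nat) (y : R) :
  0 < lam -> measurable_fun setT X ->
  (forall A, measurable A -> P (X @^-1` A) = exponential_prob lam A) -> 0 <= y ->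
  (\int[P]_w (Num.max 0 (y - X w) ^+ m.+2 +
    m.+2%:R / lam * Num.max 0 (y - X w) ^+ m.+1)%:E = (y ^+ m.+2)%:E)%E.
Proof.
move=> lam0 mX hX y0.
have mm : measurable_fun setT (fun x : R => Num.max 0 (y - x)).
  by apply: measurable_maxr => //; exact: measurable_funB.
rewrite (@ge0_integral_exponential lam X (fun x => Num.max 0 (y - x) ^+ m.+2 +
    m.+2%:R / lam * Num.max 0 (y - x) ^+ m.+1))//; last 2 first.
- apply: measurable_funD; first exact: measurable_funX.
  by apply: measurable_funM => //; exact: measurable_funX.
- move=> x; have h : 0 <= Num.max 0 (y - x) by rewrite le_max lexx.
  by rewrite addr_ge0 ?exprn_ge0// mulr_ge0 ?divr_ge0 ?exprn_ge0// ltW.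
pose f x := ((y - x) ^+ m.+2 + m.+2%:R / lam * (y - x) ^+ m.+1) *
  (lam * expR (- lam * x)).
transitivity (\int[leb]_(x in `[0%R, y]) (f x)%:E)%E.
  rewrite [RHS]integral_mkcond; apply: eq_integral => x _; rewrite patchE.
  case: ifPn => [|/negP xN].
    rewrite inE/= in_itv/= => /andP[x0 xy].
    by rewrite max_r ?subr_ge0// exponential_pdfE.
  have [x0|x0] := ltP x 0; first by rewrite lt0_exponential_pdf// mulr0.
  have xy : y < x.
    by rewrite ltNge; apply/negP => xy; apply: xN; rewrite inE/= in_itv/= x0.
  by rewrite max_l ?subr_le0 1?ltW// !expr0n/= mulr0 addr0 mul0r.
have [y00|yn0] := eqVneq y 0.
  by rewrite y00 set_itv1 integral_set1 expr0n.
have {}y0 : 0 < y by rewrite lt_neqAle eq_sym yn0.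
(* The integrand is an exact derivative: differentiating the power yields the term in
   [m.+2%:R / lam], differentiating the exponential yields the other one. *)
pose F x := - ((y - x) ^+ m.+2 * expR (- lam * x)).
have dF (x : R) : is_derive x 1 F (f x).
  have d1 : is_derive x 1 (fun x0 : R => y - x0) (0 - 1) by exact: is_deriveB.
  have d2 : is_derive x 1 (fun x0 : R => - lam * x0) (- lam *: 1).
    exact: is_deriveZ.
  have d3 := @is_deriveX _ _ _ m.+2 x 1 _ d1.
  have d4 := @is_derive1_comp R expR _ x _ _ (is_derive_expR _) d2.
  have -> : F = - ((fun x0 : R => y - x0) ^+ m.+2 * (expR \o (fun x0 => - lam * x0))).
    by apply/funext => z; rewrite /F !fctE.
  apply: (is_derive_eq (is_deriveN (is_deriveM d3 d4))).
  rewrite /f /GRing.scale/= exprfctE; move: (expR _) => e.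
  by rewrite exprS; field; rewrite gt_eqF.
have cF : continuous F.
  by move=> x; apply/differentiable_continuous/derivable1_diffP; exact: (@ex_derive _ _ _ _ _ _ _ (dF x)).
have cf : continuous f.
  have cX n : continuous (fun x : R => (y - x) ^+ n).
    move=> x; apply: (@cvg_comp _ _ _ (fun x => y - x) (fun z => z ^+ n)).
      by apply: cvgB; [exact: cvg_cst|exact: cvg_id].
    exact: exprn_continuous.
  move=> x; apply: cvgM.
    apply: cvgD; first exact: cX.
    by apply: cvgM; [exact: cvg_cst|exact: cX].
  apply: cvgM; first exact: cvg_cst.
  apply: (@cvg_comp _ _ _ (fun x => - lam * x) expR); last exact: continuous_expR.
  by apply: cvgM; [exact: cvg_cst|exact: cvg_id].
rewrite (@continuous_FTC2 _ f F)//.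
- by rewrite /F -EFinB subrr expr0n/= mul0r !oppr0 addr0 mulr0 expR0 mulr1 add0r opprK.
- exact: continuous_subspaceT.
- split.
  + by move=> x _; exact: (@ex_derive _ _ _ _ _ _ _ (dF x)).
  + by apply: cvg_at_right_filter; exact: cF.
  + by apply: cvg_at_left_filter; exact: cF.
- by move=> x _; rewrite derive1E; exact: (@derive_val _ _ _ _ _ _ _ (dF x)).
Qed.

Lemma exponential_tail (mu v : R) : 0 < mu -> 0 <= v ->
  exponential_prob mu `]v, +oo[ = (expR (- mu * v))%:E.
Proof.
move=> mu0 v0; rewrite /exponential_prob integral_itv_obnd_cbnd; last first.
  by apply/measurable_EFinP/measurable_funTS; exact: measurable_exponential_pdf.
have cF : continuous (fun x : R => - expR (- mu * x)).
  move=> x; apply: cvgN.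
  apply: (@cvg_comp _ _ _ (fun x => - mu * x) expR); last exact: continuous_expR.
  by apply: cvgM; [exact: cvg_cst|exact: cvg_id].
rewrite (@ge0_continuous_FTC2y _ _ (fun x => - (expR (- mu * x))) v 0)//.
- by rewrite EFinN oppeK add0e.
- by move=> x _; apply: exponential_pdf_ge0; exact: ltW.
- apply: (@continuous_subspaceW R^o _ _ [set` `[0, +oo[%R]).
    by apply: subset_itvr; rewrite bnd_simp.
  exact: within_continuous_exponential_pdf.
- rewrite -oppr0; apply: cvgN.
  rewrite (_ : (fun x => expR (- mu * x)) =
               (fun z => expR (- z)) \o (fun z => mu * z)); last first.
    by apply: eq_fun => x; rewrite mulNr.
  apply: (@cvg_comp _ _ _ _ _ _ (pinfty_nbhs R)); last exact: cvgr_expR.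
  exact: gt0_cvgMry.
- by apply/cvg_at_right_filter; exact: cF.
- move=> x; rewrite in_itv/= andbT => vx; apply: derive1_exponential_pdf.
  by rewrite in_itv/= andbT (le_lt_trans v0).
Qed.

(** Half of the rate absorbs the power, by [(mu x / 2)^m <= m! exp (mu x / 2)]; what remains is
    twice a density of rate [mu / 2]. The absolute value is there because [S] is nonnegative only
    almost surely. *)
Lemma exponential_moment_le (mu : R) (S : Omega -> R) m :
  0 < mu -> measurable_fun setT S ->
  (forall A, measurable A -> P (S @^-1` A) = exponential_prob mu A) ->
  (\int[P]_w (`|S w| ^+ m)%:E <= (m`!%:R * (2 / mu) ^+ m * 2)%:E)%E.
Proof.
move=> mu0 mS hS.
have c0 : 0 <= m`!%:R * (2 / mu) ^+ m * 2.
  by rewrite !mulr_ge0// exprn_ge0// divr_ge0// ltW.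
have mx : measurable_fun setT (fun x : R => `|x| ^+ m).
  by apply: measurable_funX; exact: normr_measurable.
rewrite (@ge0_integral_exponential mu S (fun x => `|x| ^+ m))//.
have mu20 : 0 < mu / 2 by rewrite divr_gt0.
apply: (@le_trans _ _ (\int[leb]_x ((m`!%:R * (2 / mu) ^+ m * 2)%:E *
    (exponential_pdf (mu / 2) x)%:E))%E).
  apply: ge0_le_integral => //.
  - by move=> x _; rewrite lee_fin mulr_ge0 ?exprn_ge0 ?exponential_pdf_ge0// ltW.
  - apply/measurable_EFinP; apply: measurable_funM => //.
    exact: measurable_exponential_pdf.
  - apply: emeasurable_funM => //; apply/measurable_EFinP.
    exact: measurable_exponential_pdf.
  move=> x _; rewrite -EFinM lee_fin.
  have [x0|x0] := ltP x 0; first by rewrite !lt0_exponential_pdf// !mulr0.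
  rewrite !exponential_pdfE// ger0_norm//.
  have h : (mu / 2 * x) ^+ m <= m`!%:R * expR (mu / 2 * x).
    have z0 : 0 <= mu / 2 * x by rewrite mulr_ge0// ltW.
    case: m {c0 mx} => [|n].
      by rewrite expr0 fact0 mul1r (le_trans _ (expR_ge1Dx _))// lerDl.
    have hz := expR_ge1Dxn n z0.
    rewrite [leRHS]mulrC -ler_pdivrMr ?ltr0n ?fact_gt0//.
    by apply: le_trans hz; rewrite lerDr.
  have -> : x ^+ m = (2 / mu) ^+ m * (mu / 2 * x) ^+ m.
    by rewrite -exprMn; congr (_ ^+ m); field; rewrite gt_eqF.
  have -> : m`!%:R * (2 / mu) ^+ m * 2 * (mu / 2 * expR (- (mu / 2) * x)) =
     (2 / mu) ^+ m * (m`!%:R * expR (mu / 2 * x)) * (mu * expR (- mu * x)).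
    rewrite (_ : - mu * x = - (mu / 2) * x - (mu / 2) * x); last by field.
    rewrite expRD mulNr expRN.
    have : expR (mu / 2 * x) != 0 by rewrite gt_eqF// expR_gt0.
    by move: (expR (mu / 2 * x)) => e e0; field; rewrite ?e0 ?gt_eqF.
  apply: ler_wpM2r; first by rewrite mulr_ge0 ?expR_ge0// ltW.
  by apply: ler_wpM2l => //; rewrite exprn_ge0// divr_ge0// ltW.
rewrite ge0_integralZl_EFin//; last 2 first.
- by move=> x _; rewrite lee_fin exponential_pdf_ge0// ltW.
- by apply/measurable_EFinP; exact: measurable_exponential_pdf.
by rewrite integral_exponential_pdf// mule1.
Qed.

End exponential_law.

(** * Moments of variables whose tail is a signed mixture of exponentials *)

Section exponential_tails.
Context (R : realType).
Local Notation leb := (@lebesgue_measure R).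

Lemma cvg_expR_scaled (a : R) : 0 < a -> expR (- (a * x)) @[x --> +oo] --> 0.
Proof.
move=> a0.
apply: (@cvg_comp _ _ _ (fun x => a * x) (fun x => expR (- x)) _ (pinfty_nbhs R)).
  exact: gt0_cvgMry.
exact: cvgr_expR.
Qed.

Lemma integral_expR (a : R) : 0 < a ->
  (\int[leb]_(x in `[0%R, +oo[) (expR (- (a * x)))%:E = a^-1%:E)%E.
Proof.
move=> a0.
have dF (x : R) : is_derive x 1 (fun x : R => - a^-1 * expR (- (a * x)))
    (expR (- (a * x))).
  have d2 : is_derive x 1 (fun x0 : R => - a * x0) (- a *: 1).
    exact: is_deriveZ.
  have d4 := @is_derive1_comp R expR _ x _ _ (is_derive_expR _) d2.
  have -> : (fun x : R => - a^-1 * expR (- (a * x))) =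
      - a^-1 \*: (expR \o (fun x0 => - a * x0)).
    by apply/funext => z; rewrite /= /GRing.scale/= !mulNr.
  apply: (is_derive_eq (is_deriveZ (- a^-1) d4)).
  rewrite /GRing.scale/= [- a * x]mulNr; move: (expR _) => e.
  by field; rewrite gt_eqF.
have cf : continuous (fun x : R => expR (- (a * x))).
  move=> x; apply: (@cvg_comp _ _ _ (fun x => - (a * x)) expR).
    by apply: cvgN; apply: cvgM; [exact: cvg_cst|exact: cvg_id].
  exact: continuous_expR.
rewrite (@ge0_continuous_FTC2y _ _ (fun x => - a^-1 * expR (- (a * x))) 0 0).
- by rewrite mulr0 oppr0 expR0 mulr1 -EFinB sub0r opprK.
- by move=> x _; exact: expR_ge0.
- exact: continuous_subspaceT.
- suff : (fun x : R => - a^-1 * expR (- (a * x))) @ +oo --> - a^-1 * 0.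
    by rewrite mulr0.
  by apply: cvgM; [exact: cvg_cst|exact: cvg_expR_scaled].
- by move=> x _; exact: (@ex_derive _ _ _ _ _ _ _ (dF x)).
- apply: cvg_at_right_filter.
  apply: (@cvgM _ _ _ _ (cst (- a^-1)) (fun x => expR (- (a * x)))).
    exact: cvg_cst.
  exact: cf.
- by move=> x _; rewrite derive1E; exact: (@derive_val _ _ _ _ _ _ _ (dF x)).
Qed.

Lemma integral_expR_sqrt (a : R) : 0 < a ->
  (\int[leb]_(x in `[0%R, +oo[) (expR (- (a * Num.sqrt x)))%:E =
   (2 / a ^+ 2)%:E)%E.
Proof.
move=> a0.
(* Primitive found by substituting [x = s^2] and integrating by parts. The square root is not
   differentiable at 0, so the derivative is only claimed for [x > 0]. *)
pose F (x : R) := (a * Num.sqrt x + 1) * (- (2 / a ^+ 2) * expR (- (a * Num.sqrt x))).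
have cs : continuous (fun x : R => a * Num.sqrt x).
  by move=> x; apply: cvgM; [exact: cvg_cst|exact: sqrt_continuous].
have cf : continuous (fun x : R => expR (- (a * Num.sqrt x))).
  move=> x; apply: (@cvg_comp _ _ _ (fun x => - (a * Num.sqrt x)) expR).
    by apply: cvgN; exact: cs.
  exact: continuous_expR.
have cF : continuous F.
  move=> x; apply: cvgM.
    by apply: cvgD; [exact: cs|exact: cvg_cst].
  by apply: cvgM; [exact: cvg_cst|exact: cf].
have dF (x : R) : 0 < x -> is_derive x 1 F (expR (- (a * Num.sqrt x))).
  move=> x0.
  have d0 := is_derive1_sqrt x0.
  have d1 := is_deriveZ a d0.
  have d2 := is_deriveD d1 (is_derive_cst (1 : R) x 1).
  have d4 := @is_derive1_comp R expR _ x _ _ (is_derive_expR _) (is_deriveN d1).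
  have -> : F = (a \*: Num.sqrt + cst 1) *
      (- (2 / a ^+ 2) \*: (expR \o - (a \*: Num.sqrt))).
    by apply/funext => z.
  apply: (is_derive_eq (is_deriveM d2 (is_deriveZ (- (2 / a ^+ 2)) d4))).
  rewrite !fctE /GRing.scale/=; move: (expR _) => e.
  have s0 : Num.sqrt x != 0 by rewrite gt_eqF// sqrtr_gt0.
  have sE (u v : R) : u *: v = u * v by [].
  by rewrite !sE; move: (Num.sqrt x) s0 => s s0; field; rewrite s0 gt_eqF.
rewrite (@ge0_continuous_FTC2y _ _ F 0 0).
- rewrite -EFinB; congr EFin; rewrite /F sqrtr0 mulr0 oppr0 expR0; ring.
- by move=> x _; exact: expR_ge0.
- exact: continuous_subspaceT.
- have h : (fun x : R => (2 / a ^+ 2) * (2 * expR (- (a / 2 * Num.sqrt x)))) @ +oo --> 0.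
    have -> : (0 : R) = 2 / a ^+ 2 * (2 * 0) by rewrite !mulr0.
    apply: cvgM; first exact: cvg_cst.
    apply: cvgM; first exact: cvg_cst.
    apply: (@cvg_comp _ _ _ Num.sqrt (fun x => expR (- (a / 2 * x))) _ (pinfty_nbhs R)).
      apply/cvgryPge => A; near=> x.
      have [A0|A0] := leP A 0; first exact: le_trans (sqrtr_ge0 _).
      have hx : A ^+ 2 <= x.
        by near: x; apply: nbhs_pinfty_ge; exact: num_real.
      have x0 : 0 <= x by exact: le_trans (sqr_ge0 A) hx.
      by rewrite -(ler_pXn2r (n := 2))// ?nnegrE ?sqrtr_ge0// ?sqr_sqrtr// ltW.
    exact: cvg_expR_scaled (divr_gt0 a0 _).
  apply: (@squeeze_cvgr _ _ _ _ (fun x => - ((2 / a ^+ 2) * (2 * expR (- (a / 2 * Num.sqrt x))))) (cst 0)).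
  + apply: nearW => x; rewrite /F.
    have z0 : 0 <= a * Num.sqrt x by rewrite mulr_ge0// ltW.
    have c0 : 0 <= 2 / a ^+ 2 by rewrite divr_ge0// sqr_ge0.
    have e0 := expR_ge0 (- (a * Num.sqrt x)).
    apply/andP; split; last first.
      by rewrite mulr_ge0_le0 ?addr_ge0// mulr_le0_ge0// oppr_le0.
    rewrite [leRHS]mulrCA [leRHS]mulNr lerN2 ler_wpM2l//.
    (* With [z = a sqrt x / 2], the bound [1 + 2 z <= 2 exp z] turns [(1 + 2 z) exp (- 2 z)] into at
       most [2 exp (- z)]. *)
    have := expR_ge1Dx (a / 2 * Num.sqrt x).
    rewrite (_ : - (a * Num.sqrt x) = - (a / 2 * Num.sqrt x) - (a / 2 * Num.sqrt x)); last by field.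
    rewrite expRD expRN.
    rewrite (_ : a * Num.sqrt x = 2 * (a / 2 * Num.sqrt x)); last by field.
    move: (a / 2 * Num.sqrt x) (expR_gt0 (a / 2 * Num.sqrt x)) => z.
    move: (expR z) => e {}e0 ze.
    have -> : 2 / e = (2 * e) * (e^-1 * e^-1) by field; rewrite gt_eqF.
    rewrite ler_wpM2r ?mulr_ge0 ?invr_ge0 ?ltW//; lra.
  + by rewrite -oppr0; exact: cvgN.
  + exact: cvg_cst.
- by move=> x x0; exact: (@ex_derive _ _ _ _ _ _ _ (dF x x0)).
- by apply: cvg_at_right_filter; exact: cF.
- move=> x; rewrite in_itv/= andbT => x0.
  by rewrite derive1E; exact: (@derive_val _ _ _ _ _ _ _ (dF x x0)).
Unshelve. all: by end_near. Qed.

Context d (Omega : measurableType d) (P : probability Omega R).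

(** Integrate the tail over [v >= 0]. The coefficients may be negative, so the sum is exchanged with
    the integral by integrability of each exponential and not by positivity. [tailE] treats [V] and
    [V ^+ 2] together, the latter through [s = Num.sqrt]. *)
Lemma moments_exponential_tail (I : finType) (c a : I -> R) (V : Omega -> R) :
  (forall i, 0 < a i) -> measurable_fun setT V -> (forall w, 0 <= V w) ->
  (forall v, 0 <= v ->
     P [set w | v < V w] = (\sum_i c i * expR (- (a i * v)))%:E) ->
  (\int[P]_w (V w)%:E = (\sum_i c i / a i)%:E /\
   \int[P]_w (V w ^+ 2)%:E = (\sum_i c i * (2 / a i ^+ 2))%:E)%E.
Proof.
move=> a0 mV V0 tail.
have tailE (Z : Omega -> R) (s : R -> R) (m : I -> R) : measurable_fun setT Z ->
    (forall w, 0 <= Z w) -> (forall v, 0 <= v -> 0 <= s v) ->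
    measurable_fun setT s ->
    (forall v, 0 <= v -> [set w | v < Z w] = [set w | s v < V w]) ->
    (forall i, \int[leb]_(v in `[0%R, +oo[) (expR (- (a i * s v)))%:E = (m i)%:E)%E ->
    (\int[P]_w (Z w)%:E = (\sum_i c i * m i)%:E)%E.
  move=> mZ Z0 s0 ms Zs sm.
  pose Z' : {RV P >-> R} := mfun_Sub (mem_set mZ).
  have := @ge0_expectation_ccdf _ _ _ P Z' Z0; rewrite expectation_def => ->.
  have mE i : measurable_fun setT (fun v => expR (- (a i * s v))).
    apply: (measurableT_comp (@measurable_expR R)).
    by apply: measurableT_comp => //; exact: measurable_funM.
  have iE i : leb.-integrable `[0, +oo[ (fun v => (expR (- (a i * s v)))%:E).
    apply/integrableP; split.
      by apply/measurable_EFinP; apply: measurable_funTS; exact: mE.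
    under eq_integral do rewrite /= ger0_norm ?expR_ge0//.
    by rewrite sm ltry.
  transitivity (\int[leb]_(v in `[0%R, +oo[)
      (\sum_i ((c i)%:E * (expR (- (a i * s v)))%:E)))%E.
    apply: eq_integral => v; rewrite inE/= in_itv/= andbT => v0.
    under eq_bigr do rewrite -EFinM.
    rewrite sumEFin -tail ?s0// -Zs// /ccdf /distribution /pushforward/=.
    by congr (P _); apply/seteqP; split => w /=; rewrite in_itv/= andbT.
  rewrite integral_sum//; last by move=> i; exact: integrableZl.
  rewrite -sumEFin; apply: eq_bigr => i _.
  by rewrite integralZl// sm.
split.
- apply: (tailE V id) => // i; exact: integral_expR.
- apply: (tailE _ Num.sqrt) => //.
  + exact: measurable_funX.
  + by move=> w; rewrite sqr_ge0.
  + by apply: continuous_measurable_fun; exact: sqrt_continuous.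
  + move=> v v0; apply/seteqP; split => w /= h.
      by rewrite -(ltr_pXn2r (n := 2))// ?nnegrE ?sqrtr_ge0// sqr_sqrtr.
    by rewrite -(sqr_sqrtr v0) ltr_pXn2r// nnegrE ?sqrtr_ge0.
  + by move=> i; exact: integral_expR_sqrt.
Qed.

End exponential_tails.

(** * The beta integral and alternating binomial sums *)

Section beta.
Context (R : realType).
Local Notation leb := (@lebesgue_measure R).

Lemma integral_onem_powR (b : R) : 0 < b ->
  (\int[leb]_(v in `[0%R, 1%R[) ((1 - v) `^ (b - 1))%:E = b^-1%:E)%E.
Proof.
move=> b0; pose f v : R := (1 - v) `^ (b - 1).
pose F v : R := - b^-1 * (1 - v) `^ b.
have d1 (x : R) : is_derive x 1 (fun v : R => 1 - v) (0 - 1) by exact: is_deriveB.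
have dF (x : R) : x < 1 -> is_derive x 1 F (f x).
  move=> x1; have x1' : 0 < 1 - x by rewrite subr_gt0.
  have d2 := @is_derive1_comp R (@powR R ^~ b) _ x _ _ (is_derive1_powR b x1') (d1 x).
  have -> : F = - b^-1 \*: ((@powR R ^~ b) \o (fun v => 1 - v)) by apply/funext.
  apply: (is_derive_eq (is_deriveZ (- b^-1) d2)).
  by rewrite /GRing.scale/= /f; field; rewrite gt_eqF.
have cf (x : R) : x < 1 -> {for x, continuous f}.
  move=> x1; have x1' : 0 < 1 - x by rewrite subr_gt0.
  have d2 := @is_derive1_comp R (@powR R ^~ (b - 1)) _ x _ _
    (is_derive1_powR (b - 1) x1') (d1 x).
  apply/differentiable_continuous/derivable1_diffP.
  exact: (@ex_derive _ _ _ _ _ _ _ d2).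
have cF (x : R) : x < 1 -> {for x, continuous F}.
  move=> x1; apply/differentiable_continuous/derivable1_diffP.
  exact: (@ex_derive _ _ _ _ _ _ _ (dF x x1)).
(* For [b < 1] the integrand is unbounded near 1, so the interval is exhausted from the left; the
   offset 2 keeps [c n] strictly positive. *)
pose c n : R := 1 - n.+2%:R^-1.
have c1 n : c n < 1 by rewrite ltrBlDr ltrDl.
have c0 n : 0 < c n by rewrite subr_gt0 invf_lt1// ltr1n.
have FE n : (\int[leb]_(v in `[0%R, c n]) (f v)%:E =
    (b^-1 - b^-1 * n.+2%:R^-1 `^ b)%:E)%E.
  rewrite (@continuous_FTC2 _ f F)//.
  - rewrite /F /c opprB addrCA subrr addr0 subr0 powR1 mulr1 -EFinB.
    by rewrite mulNr opprK addrC.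
  - apply: continuous_in_subspaceT => x; rewrite inE/= in_itv/= => /andP[_ xc].
    by apply: cf; exact: le_lt_trans xc (c1 n).
  - split.
    + move=> x; rewrite in_itv/= => /andP[_ xc].
      exact: (@ex_derive _ _ _ _ _ _ _ (dF x (lt_trans xc (c1 n)))).
    + by apply: cvg_at_right_filter; apply: cF.
    + by apply: cvg_at_left_filter; apply: cF; exact: c1.
  - move=> x; rewrite in_itv/= => /andP[_ xc]; rewrite derive1E.
    exact: (@derive_val _ _ _ _ _ _ _ (dF x (lt_trans xc (c1 n)))).
have iU : `[0%R, 1%R[%classic = \bigcup_n `[0%R, c n]%classic.
  apply/seteqP; split => x /=; rewrite in_itv/=.
    move=> /andP[x0 x1].
    have x1' : 0 < 1 - x by rewrite subr_gt0.
    have [n hn] := ltr_add_invr x1'; rewrite add0r in hn.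
    exists n => //=; rewrite in_itv/= x0/= lerBrDr -lerBrDl.
    apply: le_trans (ltW hn).
    by rewrite lef_pV2 ?posrE// ler_nat.
  by move=> [n _]; rewrite /= in_itv/= => /andP[-> /le_lt_trans]; apply.
have mf : measurable_fun setT f.
  apply: (measurableT_comp (@measurable_powR R (b - 1))).
  exact: measurable_funB.
have lim1 : (\int[leb]_(v in `[0%R, c n]) (f v)%:E @[n --> \oo] -->
    \int[leb]_(v in `[0%R, 1%R[) (f v)%:E)%E.
  rewrite iU; apply: ge0_nondecreasing_set_cvg_integral => //.
  - apply/nondecreasing_seqP => n; apply/subsetPset => x /=; rewrite !in_itv/=.
    move=> /andP[-> /le_trans]; apply; rewrite /c lerB// lef_pV2 ?posrE//.
    by rewrite ler_nat.
  - by move=> n; apply/measurable_EFinP; exact: measurable_funTS.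
  - by move=> n x _; rewrite lee_fin powR_ge0.
have lim2 : (\int[leb]_(v in `[0%R, c n]) (f v)%:E @[n --> \oo] --> b^-1%:E)%E.
  under eq_fun do rewrite FE.
  apply: cvg_EFin; first exact: nearW.
  rewrite /= (_ : fine \o _ = (fun n : nat => b^-1 - b^-1 * n.+2%:R^-1 `^ b))//.
  suff : (fun n : nat => b^-1 - b^-1 * n.+2%:R^-1 `^ b) @ \oo --> b^-1 - b^-1 * 0.
    by rewrite mulr0 subr0.
  apply: cvgB; first exact: cvg_cst.
  apply: cvgM; first exact: cvg_cst.
  have /cvg_at_rightP := powR_cvg0 b0; apply; split => //.
  rewrite (cvg_shiftS (@harmonic R)); exact: cvg_harmonic.
exact: (cvg_unique _ lim1 lim2).
Qed.

(** Expand [v^t = (1 - (1 - v))^t] in powers of [1 - v]. The endpoint 1 is discarded beforehand so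
    that [1 - v] is positive and exponents of real powers add. *)
Lemma betaR_binomial (t r : nat) : (0 < r)%N ->
  betaR t.+1%:R r%:R^-1 =
  \sum_(j < t.+1) 'C(t, j)%:R * (-1) ^+ j / (j%:R + r%:R^-1) :> R.
Proof.
move=> r0; have rp : 0 < r%:R^-1 :> R by rewrite invr_gt0 ltr0n.
have bp (j : nat) : 0 < j%:R + r%:R^-1 :> R by rewrite ltr_wpDl.
have m1 (b : R) : measurable_fun setT (fun v : R => (1 - v) `^ b).
  by apply: (measurableT_comp (@measurable_powR R b)); exact: measurable_funB.
pose g (j : nat) v : R := (1 - v) `^ (j%:R + r%:R^-1 - 1).
have ig (j : nat) : leb.-integrable `[0%R, 1%R[ (fun v => (g j v)%:E).
  apply/integrableP; split.
    by apply/measurable_EFinP; apply: measurable_funTS; exact: m1.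
  under eq_integral do rewrite /= ger0_norm ?powR_ge0//.
  by rewrite integral_onem_powR// ltry.
rewrite /betaR /Rintegral -integral_itv_bndo_bndc; last first.
  apply/measurable_EFinP; apply: measurable_funTS; apply: measurable_funM.
    exact: measurable_powR.
  exact: m1.
rewrite (_ : integral _ _ _ =
  (\sum_(j < t.+1) 'C(t, j)%:R * (-1) ^+ j / (j%:R + r%:R^-1))%:E)//.
transitivity (\int[leb]_(v in `[0%R, 1%R[)
    (\sum_(j < t.+1) (('C(t, j)%:R * (-1) ^+ j)%:E * (g j v)%:E)))%E.
  apply: eq_integral => v; rewrite inE/= in_itv/= => /andP[v0 v1].
  under eq_bigr do rewrite -EFinM.
  rewrite sumEFin; congr EFin.
  have v1' : 0 < 1 - v by rewrite subr_gt0.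
  rewrite -natr1 addrK powR_mulrn//.
  have -> : v ^+ t = \sum_(j < t.+1) 'C(t, j)%:R * (-1) ^+ j * (1 - v) ^+ j.
    rewrite -[v in LHS](subKr 1) exprBn; apply: eq_bigr => j _.
    by rewrite expr1n mulr1 -mulr_natl mulrA.
  rewrite mulr_suml; apply: eq_bigr => j _; rewrite -[LHS]mulrA; congr (_ * _).
  rewrite /g -addrA [RHS]powRD; last by apply/implyP => _; rewrite gt_eqF.
  by rewrite powR_mulrn// ltW.
rewrite integral_sum//; last by move=> j; exact: integrableZl.
rewrite -sumEFin; apply: eq_bigr => j _.
by rewrite integralZl// integral_onem_powR.
Qed.

(** Both sides are the integral of [(1 - x)^m] over the unit interval. The algebraic proof absorbs
    [l + 1] into the binomial coefficient and expands [(1 - 1)^(m+1) = 0]. *)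
Lemma sum_alt_bin_inv (m : nat) :
  \sum_(l < m.+1) (-1) ^+ l * 'C(m, l)%:R / l.+1%:R = m.+1%:R^-1 :> R.
Proof.
apply: (@mulfI _ m.+1%:R); first by rewrite pnatr_eq0.
rewrite mulfV ?pnatr_eq0// mulr_sumr.
transitivity (\sum_(l < m.+1) - ((-1) ^+ l.+1 * 'C(m.+1, l.+1)%:R) : R).
  apply: eq_bigr => l _.
  have h : m.+1%:R * 'C(m, l)%:R = l.+1%:R * 'C(m.+1, l.+1)%:R :> R.
    by rewrite -!natrM mul_bin_diag.
  have -> : 'C(m.+1, l.+1)%:R = m.+1%:R * 'C(m, l)%:R / l.+1%:R :> R.
    by rewrite h mulrAC mulfV ?pnatr_eq0// mul1r.
  by rewrite exprS mulN1r mulNr opprK !mulrA [m.+1%:R * _]mulrC.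
rewrite sumrN.
have : (1 - 1) ^+ m.+1 = 0 :> R by rewrite subrr expr0n.
rewrite exprBn big_ord_recl/= expr0 !expr1n !mul1r bin0 mulr1n.
under eq_bigr => i _ do rewrite /bump/= add1n !expr1n !mulr1 -mulr_natr.
by move/eqP; rewrite addr_eq0 => /eqP <-.
Qed.

(** Since [1 / (j + 1/r) = r / (r j + 1)], a second expansion writes [eta] through the means
    [1 / ((l+1) mu)] of exponentials, the form in which the mean of a service is computed from its
    tail. *)
Lemma eta_binomial (mu : R) (t r : nat) : 0 < mu -> (0 < r)%N ->
  (mu * r%:R)^-1 * betaR t.+1%:R r%:R^-1 =
  \sum_(j < t.+1) \sum_(l < (r * j).+1)
    ('C(t, j)%:R * (-1) ^+ j * ((-1) ^+ l * 'C(r * j, l)%:R)) / (l.+1%:R * mu).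
Proof.
move=> mu0 r0; rewrite betaR_binomial// mulr_sumr; apply: eq_bigr => j _.
have rn0 : r%:R != 0 :> R by rewrite pnatr_eq0 -lt0n.
transitivity ('C(t, j)%:R * (-1) ^+ j / mu * (r * j).+1%:R^-1).
  have : (r * j).+1%:R != 0 :> R by rewrite pnatr_eq0.
  have -> : (j%:R + r%:R^-1 : R) = (r * j).+1%:R / r%:R.
    by rewrite -natr1 natrM; field.
  move: ((r * j).+1%:R) => x x0; field.
  by rewrite x0 rn0 gt_eqF.
rewrite -sum_alt_bin_inv mulr_sumr; apply: eq_bigr => l _.
have : l.+1%:R != 0 :> R by rewrite pnatr_eq0.
by move: (l.+1%:R) => x x0; field; rewrite x0 gt_eqF.
Qed.

End beta.

(** * Cylinder events *)

Section independent_events.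
Context d (Omega : measurableType d) (R : realType) (P : probability Omega R).
Implicit Types (A B D : set Omega) (G : set (set Omega)).

(** [P] restricted to [D] and [P] scaled by [P D] are measures that agree on a family closed under
    intersection, hence on the sigma-algebra it generates. *)
Lemma indep_sigma G (g : nat -> set Omega) D :
  G `<=` measurable -> setI_closed G -> (forall k, G (g k)) ->
  \bigcup_k g k = setT -> measurable D ->
  (forall A, G A -> P (A `&` D) = P A * P D)%E ->
  forall A, <<s G >> A -> (P (A `&` D) = P A * P D)%E.
Proof.
move=> Gm GI Gg gT mD GD A sA.
have PD0 : 0 <= fine (P D) by rewrite fine_ge0.
have sc B : mscale (NngNum PD0) P B = (P B * P D)%E.
  by rewrite /mscale/= fineK ?fin_num_measure// muleC.
rewrite -sc -[LHS]/(mrestr P mD A).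
apply: (@g_sigma_algebra_measure_unique _ _ _ G Gm g Gg gT) => //.
  by move=> B GB; exact: etrans (GD B GB) (esym (sc B)).
move=> k; rewrite /mrestr (le_lt_trans _ (ltry 1))//.
by apply: probability_le1; apply: measurableI => //; exact: Gm.
Qed.

(** Rays form an intersection-closed generator of the Borel sets, so only tails ever have to be
    computed. *)
Lemma indep_borel D (xi : Omega -> R) :
  measurable D -> measurable_fun setT xi ->
  (forall v, P (D `&` [set w | v < xi w]) = (P D * P [set w | v < xi w]%R)%E) ->
  forall B : set R, measurable B -> (P (D `&` xi @^-1` B) = P D * P (xi @^-1` B))%E.
Proof.
move=> mD mxi Dv B mB.
pose G := preimage_set_system setT xi (@RGenOInfty.G R).
have rayE v : xi @^-1` `]v, +oo[ = [set w | v < xi w].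
  by apply/seteqP; split => w /=; rewrite in_itv/= andbT.
have GE A : G A -> exists v, A = [set w | v < xi w].
  by move=> [_ [v ->] <-]; exists v; rewrite setTI rayE.
have GI v : G [set w | v < xi w].
  by exists `]v, +oo[%classic; [exists v|rewrite setTI rayE].
rewrite setIC muleC.
apply: (@indep_sigma G (fun k => [set w | - k%:R < xi w])) => //.
- move=> A /GE[v ->]; rewrite -rayE -[X in measurable X]setTI.
  by apply: mxi => //; exact: measurable_itv.
- move=> A A' /GE[v ->] /GE[v' ->].
  rewrite (_ : _ `&` _ = [set w | Num.max v v' < xi w]); first exact: GI.
  by apply/seteqP; split => w /=; rewrite gt_max => /andP.
- apply/seteqP; split => // w _; exists (Num.trunc `|xi w|).+1 => //=.
  rewrite ltrNl; apply: (le_lt_trans _ (truncnS_gt _)).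
  by rewrite -normrN ler_norm.
- by move=> A /GE[v ->]; rewrite setIC muleC.
- rewrite /G g_sigma_preimageE; exists B; last by rewrite setTI.
  by rewrite -RGenOInfty.measurableE.
Qed.

Lemma probability_partition (T : finType) (f : Omega -> T) A :
  (forall s, measurable (f @^-1` [set s])) -> measurable A ->
  P A = (\sum_s P (A `&` f @^-1` [set s]))%E.
Proof.
move=> mf mA.
have H (s : seq T) : uniq s ->
    P (A `&` [set w | f w \in s]) = (\sum_(x <- s) P (A `&` f @^-1` [set x]))%E.
  have ms (u : seq T) : measurable [set w | f w \in u].
    elim: u => [|x u IH].
      by rewrite (_ : [set _ | _] = set0)//; apply/seteqP; split.
    rewrite (_ : [set _ | _] = f @^-1` [set x] `|` [set w | f w \in u]).
      exact: measurableU.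
    apply/seteqP; split => w /=; rewrite inE.
      by move=> /orP[/eqP|]; [left|right].
    by move=> [->|->]; rewrite ?eqxx ?orbT.
  elim: s => [_|x s IH /=/andP[xs us]].
    rewrite big_nil (_ : [set _ | _] = set0) ?setI0 ?measure0//.
    by apply/seteqP; split.
  rewrite big_cons -IH// -measureU.
  - congr (P _); rewrite -setIUr; congr (_ `&` _).
    apply/seteqP; split => w /=; rewrite inE.
      by move=> /orP[/eqP|]; [left|right].
    by move=> [->|->]; rewrite ?eqxx ?orbT.
  - exact: measurableI.
  - exact: measurableI.
  - apply/seteqP; split => // w /= [[_ fx] [_]]; rewrite fx.
    by rewrite (negbTE xs).
rewrite -big_enum/= -H ?enum_uniq//; congr (P _); apply/seteqP; split => w /=.
  by move=> Aw; split => //; rewrite mem_enum.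
by case.
Qed.

End independent_events.

Section cylinders.
Context d (Omega : measurableType d) (R : realType) (P : probability Omega R).
Context (I : eqType) (E : I -> set (set Omega)).
Hypothesis E_meas : forall x, E x `<=` measurable.
Hypothesis E_setI : forall x, setI_closed (E x).
Hypothesis E_setT : forall x, E x setT.
Hypothesis E_setC : forall x A, E x A -> E x (~` A).
Hypothesis ind : mutually_independent P E.
Implicit Types (J K : seq I) (B : I -> set Omega).

(** [B] is chosen on every index although only those in [J] count; two cylinders are then
    intersected coordinatewise, and a larger [J] is reached by padding with [setT]. *)
Definition cylinders J : set (set Omega) :=
  [set A | exists2 B, (forall x, E x (B x)) & A = \big[setI/setT]_(x <- J) B x].

Let bigIE J B : \big[setI/setT]_(x <- J) B x = [set w | forall x, x \in J -> B x w].
Proof.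
elim: J => [|x J IH]; first by rewrite big_nil; apply/seteqP; split.
rewrite big_cons IH; apply/seteqP; split => w /=.
  by move=> [Bx H] y; rewrite inE => /orP[/eqP ->//|/H].
by move=> H; split => [|y yJ]; apply: H; rewrite inE ?eqxx ?yJ ?orbT.
Qed.

Lemma cylinders_setI J : setI_closed (cylinders J).
Proof.
move=> _ _ [B EB ->] [B' EB' ->]; exists (fun x => B x `&` B' x).
  by move=> x; exact: E_setI.
by rewrite big_split.
Qed.

Lemma cylinders_setT J : cylinders J setT.
Proof. by exists (fun=> setT) => //; rewrite big1. Qed.

Lemma cylinders_measurable J : cylinders J `<=` measurable.
Proof.
by move=> _ [B EB ->]; apply: bigsetI_measurable => x _; exact: E_meas (EB x).
Qed.

Lemma cylinders_sub J J' : {subset J <= J'} -> cylinders J `<=` cylinders J'.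
Proof.
move=> sJ _ [B EB ->]; exists (fun x => if x \in J then B x else setT).
  by move=> x; case: ifP.
rewrite !bigIE; apply/seteqP; split => w /= H x.
  by move=> xJ'; case: ifP => // /H.
by move=> xJ; have := H x (sJ x xJ); rewrite xJ.
Qed.

Lemma cylinders1 x A : E x A -> cylinders [:: x] A.
Proof.
move=> EA; exists (fun y => if y == x then A else setT).
  by move=> y; case: eqP => // ->.
by rewrite big_seq1 eqxx.
Qed.

Lemma mem_cylinders J x A : x \in J -> E x A -> cylinders J A.
Proof.
move=> xJ /cylinders1; apply: cylinders_sub => y.
by rewrite inE => /eqP ->.
Qed.

Lemma prob_bigI J B : uniq J -> (forall x, E x (B x)) ->
  P (\big[setI/setT]_(x <- J) B x) = (\prod_(x <- J) P (B x))%E.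
Proof.
move=> uJ EB; rewrite -ind//; congr (P _); rewrite bigIE.
by apply/seteqP; split => w.
Qed.

Lemma cylinders_indep J J' A A' : uniq (J ++ J') -> cylinders J A ->
  cylinders J' A' -> (P (A `&` A') = P A * P A')%E.
Proof.
move=> uJJ [B EB ->] [B' EB' ->]; have := uJJ; rewrite cat_uniq.
move=> /and3P[uJ dis uJ'].
rewrite !prob_bigI//.
pose B2 x := if x \in J then B x else B' x.
have EB2 x : E x (B2 x) by rewrite /B2; case: ifP.
have -> : (\prod_(x <- J) P (B x) = \prod_(x <- J) P (B2 x))%E.
  by rewrite big_seq [RHS]big_seq; apply: eq_bigr => x xJ; rewrite /B2 xJ.
have nJ x : x \in J' -> (x \in J) = false.
  by move=> xJ'; apply/negP => xJ; move/hasPn: dis => /(_ x xJ')/negP; apply.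
have -> : (\prod_(x <- J') P (B' x) = \prod_(x <- J') P (B2 x))%E.
  by rewrite big_seq [RHS]big_seq; apply: eq_bigr => x xJ; rewrite /B2 nJ.
rewrite -big_cat/= -prob_bigI//; congr (P _); rewrite big_cat/=; congr (_ `&` _).
  by rewrite big_seq [RHS]big_seq; apply: eq_bigr => x xJ; rewrite /B2 xJ.
by rewrite big_seq [RHS]big_seq; apply: eq_bigr => x xJ; rewrite /B2 nJ.
Qed.

Lemma cylinders_sigma_indep J J' A D : uniq (J ++ J') -> <<s cylinders J >> A ->
  cylinders J' D -> (P (A `&` D) = P A * P D)%E.
Proof.
move=> uJJ sA cD; apply: (@indep_sigma _ _ _ P (cylinders J) (fun=> setT)) => //.
- exact: cylinders_measurable.
- exact: cylinders_setI.
- by move=> k; exact: cylinders_setT.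
- by rewrite bigcup_const.
- exact: cylinders_measurable cD.
- by move=> B cB; exact: (cylinders_indep uJJ).
Qed.

Lemma cylinders_indep_of J x (xi : Omega -> R) : uniq (rcons J x) ->
  (forall D : set R, measurable D -> E x (xi @^-1` D)) -> indep_of P (cylinders J) xi.
Proof.
move=> uJ Exi A B sA mB; apply: (cylinders_sigma_indep (J' := [:: x])) sA _.
  by rewrite cats1.
by apply: cylinders1; exact: Exi.
Qed.

(* Each factor is removed by inclusion-exclusion on the complement of a union,
   which is again a cylinder. *)
Lemma prob_inter_unions J A (b : I -> R) B (Ks : seq (seq I)) :
  (forall x, E x (B x)) -> (forall x, P (B x) = (b x)%:E) ->
  uniq (J ++ flatten Ks) -> cylinders J A ->
  P (A `&` \big[setI/setT]_(K <- Ks) \big[setU/set0]_(x <- K) B x) =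
  (P A * (\prod_(K <- Ks) (1 - \prod_(x <- K) (1 - b x)))%:E)%E.
Proof.
move=> EB Pb; elim: Ks J A => [|K Ks IH] J A uJ cA.
  by rewrite !big_nil setIT mule1.
rewrite !big_cons /=.
set U := \big[setU/set0]_(x <- K) B x.
set Q := \big[setI/setT]_(K <- Ks) _.
have mA := cylinders_measurable cA.
have mU : measurable U by apply: bigsetU_measurable => x _; exact: E_meas (EB x).
have mQ : measurable Q.
  by apply: bigsetI_measurable => L _; apply: bigsetU_measurable => x _;
    exact: E_meas (EB x).
have EBC x : E x (~` B x) by exact: E_setC.
have PbC x : P (~` B x) = (1 - b x)%:E.
  by rewrite probability_setC ?Pb//; exact: E_meas (EB x).
have CE : ~` U = \big[setI/setT]_(x <- K) ~` B x by rewrite /U setC_bigsetU.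
have cU : cylinders K (~` U) by exists (fun x => ~` B x).
have uJK : uniq (J ++ K).
  by move: uJ; rewrite /= catA cat_uniq => /andP[].
have cAU : cylinders (J ++ K) (A `&` ~` U).
  apply: cylinders_setI.
    by apply: cylinders_sub cA => x xJ; rewrite mem_cat xJ.
  by apply: cylinders_sub cU => x xJ; rewrite mem_cat xJ orbT.
have PU : P (~` U) = (\prod_(x <- K) (1 - b x))%:E.
  rewrite CE prob_bigI//; last by move: uJK; rewrite cat_uniq => /and3P[].
  by rewrite -prodEFin; apply: eq_bigr => x _; exact: PbC.
have IH1 := IH J A _ cA.
have IH2 := IH (J ++ K) (A `&` ~` U) _ cAU.
rewrite -/Q in IH1 IH2.
have {}IH1 := IH1 _; have {}IH2 := IH2 _.
have u1 : uniq (J ++ flatten Ks).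
  move: uJ => /= ; rewrite !cat_uniq => /and3P[-> h /and3P[_ _ ->]].
  rewrite andbT/=; apply: contra h => /hasP[x xK xJ]; apply/hasP; exists x => //.
  by rewrite mem_cat xK orbT.
have u2 : uniq ((J ++ K) ++ flatten Ks) by rewrite -catA.
have {}IH1 := IH1 u1; have {}IH2 := IH2 u2.
have : P (A `&` Q) = (P (A `&` ~` U `&` Q) + P (A `&` (U `&` Q)))%E.
  rewrite [LHS](measureDI P (measurableI _ _ mA mQ) mU); congr (P _ + P _)%E.
    by rewrite setDE -!setIA; congr (_ `&` _); rewrite setIC.
  by rewrite -setIA; congr (_ `&` _); rewrite setIC.
rewrite IH1 IH2 (cylinders_indep uJK cA cU) PU.
have PAf : P A \is a fin_num by rewrite fin_num_measure.
have PXf : P (A `&` (U `&` Q)) \is a fin_num.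
  by rewrite fin_num_measure//; apply: measurableI => //; exact: measurableI.
rewrite -(fineK PAf) -(fineK PXf) -!EFinM -EFinD => -[h].
congr EFin; rewrite mulrBl mul1r mulrBr h; ring.
Qed.

End cylinders.

(** * Sample paths *)

Section sample_path.
Context (R : realType) (k N t : nat).
Variables (sys : 'I_k -> 'I_N) (rec : 'I_k -> 'I_t -> {set 'I_N}).
Implicit Types (F s : 'I_N -> R) (a b : R) (i : 'I_k).

(** Download time in an empty system. Clipping at 0 makes it nonnegative on every path, whereas
    service times are so only almost surely. *)
Definition fj_service i s : R :=
  Num.max 0 (\big[Num.min/s (sys i)]_(j < t) \big[Num.max/0]_(q in rec i j) s q).

Lemma fj_step_le F a i s b : (forall q, Num.max a (F q) <= b) ->
  (fj_step sys rec F a i s).1 <= b + fj_service i s.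
Proof.
move=> Fb; have finb q : Num.max a (F q) + s q <= b + s q by rewrite lerD2r.
have ab : a <= b by have := Fb (sys i); rewrite ge_max => /andP[].
rewrite /= -lerBlDl /fj_service le_max; apply/orP; right.
apply/bigmin_geP; split.
  by rewrite lerBlDl; apply: le_trans (finb _); exact: bigmin_le_id.
move=> j _; rewrite lerBlDl.
apply: (@le_trans _ _ (\big[Num.max/a]_(q in rec i j) (Num.max a (F q) + s q))).
  exact: bigmin_le.
apply/bigmax_leP; split.
  by rewrite ler_wpDr//; exact: bigmax_ge_id.
move=> q qj; apply: le_trans (finb q) _; rewrite lerD2l.
exact: le_bigmax_cond.
Qed.

Lemma fj_download_le (X : nat -> R) (C : nat -> 'I_k) (S : nat -> 'I_N -> R) n :
  0 <= X 0%N ->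
  fj_download sys rec X C S n <=
  lindley (fun m => fj_service (C m) (S m)) (fun m => X m.+1) n +
  fj_service (C n) (S n).
Proof.
move=> X0; pose A m := \sum_(l < m.+1) X l.
pose V m := fj_service (C m) (S m).
pose W := lindley V (fun m => X m.+1).
have V0 m : 0 <= V m by rewrite le_max lexx.
have AS m : A m.+1 = A m + X m.+1 by rewrite /A big_ord_recr.
(* [A m + W m] is the start of request [m] when requests are served one at a time; in the true
   system every server is free by then. *)
have inv m q : Num.max (A m) (fj_free sys rec A C S m q) <= A m + W m.
  elim: m q => [|m IH] q.
    by rewrite /A big_ord1/= ge_max addr0 lexx.
  have dep : (fj_step sys rec (fj_free sys rec A C S m) (A m) (C m) (S m)).1 <=
      A m + W m + V m by exact: fj_step_le.
  have Fq : fj_free sys rec A C S m.+1 q <= A m + W m + V m.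
    have Fm : fj_free sys rec A C S m q <= A m + W m + V m.
      by apply: ler_wpDr => //; apply: le_trans (IH q); rewrite le_max lexx orbT.
    rewrite /=; case: ifP => // _.
    by rewrite ge_max Fm/= ge_min dep orbT.
  rewrite ge_max AS; apply/andP; split.
    by rewrite lerDl /W lindley_ge0.
  apply: (le_trans Fq); rewrite /W/= -/W -addrA -[leRHS]addrA lerD2l.
  by rewrite -lerBlDl le_max addrC lexx orbT.
by rewrite /fj_download lerBlDl addrA; apply: fj_step_le => q; exact: inv.
Qed.

(** Defined from comparisons of free times alone, so that the choice can be read off a finite table.
    The value [sys i] is a dummy for an empty group. *)
Definition fj_argmax F i (j : 'I_t) : 'I_N :=
  odflt (sys i) [pick q in rec i j | [forall q' in rec i j, F q' <= F q]].

Lemma fj_argmaxP F i j : rec i j != finset.set0 ->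
  fj_argmax F i j \in rec i j /\
  forall q, q \in rec i j -> F q <= F (fj_argmax F i j).
Proof.
move=> /finset.set0Pn[q0 q0j]; rewrite /fj_argmax; case: pickP => [q|none] /=.
  by move=> /andP[qj /forallP H]; split => // q' q'j; exact: implyP (H q') q'j.
have := none [arg max_(q > q0 in rec i j) F q]%O.
case: Order.TotalTheory.arg_maxP => //= q qj qmax.
by rewrite qj/= => /negP[]; apply/forallP => q'; apply/implyP => q'j; exact: qmax.
Qed.

(** The servers are selected from the free times alone, before the services [s] are seen; with
    disjoint groups this is a minimum of [t + 1] fresh services. *)
Definition fj_rep F i s : R :=
  Num.max 0 (\big[Num.min/s (sys i)]_(j < t) s (fj_argmax F i j)).

Definition fj_rep_if i (c : 'I_k) F s : R := if c == i then fj_rep F i s else 0.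

Hypothesis rec_neq0 : forall i j, rec i j != finset.set0.

(** A group completes no earlier than any one of its servers, so one server per group gives a lower
    bound. Taking the last one to become free preserves the wait, as it is free no earlier than the
    server known to be busy. *)
Lemma fj_download_ge (X : nat -> R) (C : nat -> 'I_k) (S : nat -> 'I_N -> R) n i :
  (forall m, 0 <= X m) -> (forall m q, 0 <= S m q) ->
  let F m := fj_free sys rec (fun m => \sum_(l < m.+1) X l) C S m in
  let V m := fj_rep_if i (C m) (F m) (S m) in
  C n = i ->
  lindley V (fun m => X m.+1) n + V n <= fj_download sys rec X C S n.
Proof.
move=> X0 S0 F V; pose A m := \sum_(l < m.+1) X l.
pose W := lindley V (fun m => X m.+1).
have AS m : A m.+1 = A m + X m.+1 by rewrite /A big_ord_recr.
have FS m q : F m q <= F m.+1 q.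
  by rewrite /F/=; case: ifP => // _; rewrite le_max lexx.
pose dep m := (fj_step sys rec (F m) (A m) (C m) (S m)).1.
pose fin m q := Num.max (A m) (F m q) + S m q.
have Vle m : C m = i -> V m <= S m (sys i) /\
    forall j, V m <= S m (fj_argmax (F m) i j).
  move=> Cm; rewrite /V /fj_rep_if Cm eqxx /fj_rep; split.
    by rewrite ge_max S0/=; exact: bigmin_le_id.
  by move=> j; rewrite ge_max S0/=; exact: (@bigmin_le _ _ _ _ j).
have depge m b : C m = i -> b <= Num.max (A m) (F m (sys i)) ->
    (forall j, exists2 q, q \in rec i j & b <= Num.max (A m) (F m q)) ->
    b + V m <= dep m.
  move=> Cm b0 bj; have [V1 V2] := Vle m Cm.
  rewrite /dep /fj_step Cm/=; apply/bigmin_geP; split; first exact: lerD.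
  move=> j _; have [qj qmax] := fj_argmaxP (F m) (rec_neq0 i j).
  apply: (@le_trans _ _ (fin m (fj_argmax (F m) i j))); last first.
    exact: (le_bigmax_cond _ (fun q => fin m q)).
  apply: lerD => //; have [q qj' bq] := bj j; apply: (le_trans bq).
  rewrite ge_max le_max lexx/= le_max; apply/orP; right; exact: qmax.
(* The blocking server of a group may change from one request to the next, hence the existential
   form. *)
have inv m : A m + W m <= Num.max (A m) (F m (sys i)) /\
    forall j, exists2 q, q \in rec i j & A m + W m <= Num.max (A m) (F m q).
  elim: m => [|m [IH0 IHj]].
    split; first by rewrite addr0 le_max lexx.
    by move=> j; have /finset.set0Pn[q qj] := rec_neq0 i j; exists q => //;
      rewrite addr0 le_max lexx.
  have WE : A m.+1 + W m.+1 = Num.max (A m.+1) (A m + W m + V m).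
    by rewrite /W/= -/W AS addr_maxr addr0; congr Num.max; ring.
  have AA : A m <= A m.+1 by rewrite AS lerDl.
  have [Cm|Cm] := eqVneq (C m) i.
    have D := depge m _ Cm IH0 IHj.
    (* An involved server is released at the minimum of its finish and the departure; if it would
       finish after the departure, it is held exactly until then or longer. *)
    have step q : (q == sys i) || [exists j, q \in rec i j] -> dep m <= fin m q ->
        A m.+1 + W m.+1 <= Num.max (A m.+1) (F m.+1 q).
      move=> hq dq; rewrite WE ge_max le_max lexx/= le_max; apply/orP; right.
      rewrite /F/= Cm hq -/(F m) le_max; apply/orP; right.
      rewrite le_min; apply/andP; split.
        exact: le_trans D dq.
      by move: D; rewrite /dep Cm.
    split.
      by apply: step; rewrite ?eqxx// /dep Cm; exact: bigmin_le_id.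
    (* If all servers of the group finished before the departure, so would the group, contradicting
       that the departure is a minimum over groups. Nonemptiness also puts the default [A m] of the
       maximum below the departure. *)
    move=> j; apply: contrapT => noq.
    have lt q : q \in rec i j -> fin m q < dep m.
      move=> qj; rewrite ltNge; apply/negP => dq; apply: noq; exists q => //.
      by apply: step => //; apply/orP; right; apply/existsP; exists j.
    have : dep m <= \big[Num.max/A m]_(q in rec i j) fin m q.
      by rewrite /dep Cm; exact: (@bigmin_le _ _ _ _ j).
    rewrite leNgt => /negP; apply; apply/bigmax_ltP; split => //.
    have /finset.set0Pn[q qj] := rec_neq0 i j.
    apply: le_lt_trans (lt q qj); rewrite /fin ler_wpDr// le_max lexx//.
  have V0 : V m = 0 by rewrite /V /fj_rep_if (negbTE Cm).
  (* A request for another file adds no work to this recursion and never decreases a free time. *)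
  have step q : A m + W m <= Num.max (A m) (F m q) ->
      A m.+1 + W m.+1 <= Num.max (A m.+1) (F m.+1 q).
    move=> h; rewrite WE V0 addr0 ge_max le_max lexx/=; apply: (le_trans h).
    rewrite ge_max le_max AA/= le_max; apply/orP; right; exact: FS.
  split; first exact: step.
  by move=> j; have [q qj h] := IHj j; exists q => //; exact: step.
move=> Cn; rewrite /fj_download lerBrDl addrA.
by have [h0 hj] := inv n; exact: depge.
Qed.

(** Only the requested file contributes, so the recursions of all files can be averaged separately
    and added. The indicator can only lower the term. *)
Lemma fj_download_ge_sum (X : nat -> R) (C : nat -> 'I_k) (S : nat -> 'I_N -> R) n :
  (forall m, 0 <= X m) -> (forall m q, 0 <= S m q) ->
  let F m := fj_free sys rec (fun m => \sum_(l < m.+1) X l) C S m in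
  let V i m := fj_rep_if i (C m) (F m) (S m) in
  \sum_i ((0 < V i n)%R%:R * lindley (V i) (fun m => X m.+1) n + V i n) <=
  fj_download sys rec X C S n.
Proof.
move=> X0 S0; pose F m := fj_free sys rec (fun m => \sum_(l < m.+1) X l) C S m.
pose V i m := fj_rep_if i (C m) (F m) (S m).
change (\sum_i ((0 < V i n)%R%:R * lindley (V i) (fun m => X m.+1) n + V i n) <=
  fj_download sys rec X C S n).
rewrite (bigD1 (C n))//= big1 ?addr0; last first.
  move=> i; rewrite eq_sym => iC.
  by rewrite /V /fj_rep_if (negbTE iC) ltxx mul0r addr0.
apply: le_trans (fj_download_ge X0 S0 (erefl (C n))).
rewrite lerD2r; apply: ler_piMl; first exact: lindley_ge0.
by case: (_ < _).
Qed.

End sample_path.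

(** * Measurability *)

Lemma measurable_fun_finite_choice d (T : measurableType d) (R : realType)
    (U : finType) (c : T -> U) (g : U -> T -> R) :
  (forall u, measurable (c @^-1` [set u])) ->
  (forall u, measurable_fun setT (g u)) ->
  measurable_fun setT (fun w => g (c w) w).
Proof.
move=> mc mg _ B mB; rewrite setTI.
rewrite (_ : _ @^-1` B =
    \big[setU/set0]_(u <- enum U) (c @^-1` [set u] `&` g u @^-1` B)).
  apply: bigsetU_measurable => u _; apply: measurableI => //.
  by rewrite -[X in measurable X]setTI; exact: mg.
rewrite -bigcup_seq; apply/seteqP; split => w /=.
  by move=> Bw; exists (c w) => //=; rewrite mem_enum.
by move=> [u _ [/= <-]].
Qed.

Lemma measurable_fun_bigop d (T : measurableType d) (R : realType)
    (op : R -> R -> R) (I : Type) (s : seq I) (p : pred I) (x0 : T -> R)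
    (f : I -> T -> R) :
  (forall g h : T -> R, measurable_fun setT g -> measurable_fun setT h ->
     measurable_fun setT (fun w => op (g w) (h w))) ->
  measurable_fun setT x0 -> (forall i, measurable_fun setT (f i)) ->
  measurable_fun setT (fun w => \big[op/x0 w]_(i <- s | p i) f i w).
Proof.
move=> mop m0 mf; elim: s => [|i s IH].
  by under eq_fun do rewrite big_nil.
under eq_fun do rewrite big_cons.
by case: (p i) => //; exact: mop.
Qed.

Section measurability.
Context d (T : measurableType d) (R : realType) (k N t : nat).
Variables (sys : 'I_k -> 'I_N) (rec : 'I_k -> 'I_t -> {set 'I_N}).

Let mmax (g h : T -> R) : measurable_fun setT g -> measurable_fun setT h ->
  measurable_fun setT (fun w => Num.max (g w) (h w)).
Proof. exact: measurable_maxr. Qed.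

Let mmin (g h : T -> R) : measurable_fun setT g -> measurable_fun setT h ->
  measurable_fun setT (fun w => Num.min (g w) (h w)).
Proof. exact: measurable_minr. Qed.

(** Measurability is asked only of inputs with [m < n], so the lemma also applies over the
    sigma-algebra of the past. *)
Lemma measurable_fj_free (A : nat -> T -> R) (C : nat -> T -> 'I_k)
    (S : nat -> 'I_N -> T -> R) n :
  (forall m, (m < n)%N -> measurable_fun setT (A m)) ->
  (forall m i, (m < n)%N -> measurable (C m @^-1` [set i])) ->
  (forall m q, (m < n)%N -> measurable_fun setT (S m q)) ->
  forall q, measurable_fun setT (fun w =>
    fj_free sys rec (A ^~ w) (C ^~ w) (fun m q => S m q w) n q).
Proof.
elim: n => [|n IH] mA mC mS q; first exact: measurable_cst.
have {}IH : forall q, measurable_fun setT (fun w =>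
    fj_free sys rec (A ^~ w) (C ^~ w) (fun m q => S m q w) n q).
  apply: IH => [m mn|m i mn|m q' mn]; [apply: mA|apply: mC|apply: mS];
    exact: ltn_trans mn (ltnSn n).
pose F w := fj_free sys rec (A ^~ w) (C ^~ w) (fun m q => S m q w) n.
pose g (i : 'I_k) (w : T) := (fj_step sys rec (F w) (A n w) i (fun q => S n q w)).2 q.
have mg i : measurable_fun setT (g i).
  rewrite /g /fj_step /=.
  case: ((q == sys i) || [exists j, q \in rec i j]); last exact: IH.
  have mfin q' : measurable_fun setT (fun w => Num.max (A n w) (F w q') + S n q' w).
    apply: measurable_funD; last exact: mS.
    by apply: mmax; [exact: mA|exact: IH].
  apply: mmax; first exact: IH.
  apply: mmin => //.
  apply: measurable_fun_bigop => // j.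
  by apply: measurable_fun_bigop => //; exact: mA.
exact: (measurable_fun_finite_choice (fun i => mC n i (ltnSn n)) mg).
Qed.

Lemma measurable_fj_service (c : T -> 'I_k) (s : 'I_N -> T -> R) :
  (forall i, measurable (c @^-1` [set i])) ->
  (forall q, measurable_fun setT (s q)) ->
  measurable_fun setT (fun w => fj_service sys rec (c w) (fun q => s q w)).
Proof.
move=> mc ms.
apply: (measurable_fun_finite_choice mc
  (g := fun i w => fj_service sys rec i (fun q => s q w))) => i.
apply: mmax => //; apply: measurable_fun_bigop => // j.
exact: measurable_fun_bigop.
Qed.

(** A summary of the free times with finitely many values that determines every selected server;
    fixing it splits the space into finitely many past events. *)
Definition comparisons (F : 'I_N -> R) : {ffun 'I_N * 'I_N -> bool} :=
  [ffun p => F p.2 <= F p.1].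

Definition argmax_of (b : {ffun 'I_N * 'I_N -> bool}) i (j : 'I_t) : 'I_N :=
  odflt (sys i) [pick q in rec i j | [forall q' in rec i j, b (q, q')]].

Lemma fj_argmaxE (F : 'I_N -> R) i j :
  fj_argmax sys rec F i j = argmax_of (comparisons F) i j.
Proof.
rewrite /fj_argmax /argmax_of; congr odflt; apply: eq_pick => q /=.
by congr (_ && _); apply: eq_forallb => q'; rewrite ffunE.
Qed.

Lemma measurable_comparisons (F : 'I_N -> T -> R) b :
  (forall q, measurable_fun setT (F q)) ->
  measurable ((fun w => comparisons (fun q => F q w)) @^-1` [set b]).
Proof.
move=> mF.
have mp p : measurable [set w | (F p.2 w <= F p.1 w) = b p].
  have : measurable_fun setT (fun w => F p.2 w <= F p.1 w).
    exact: measurable_fun_ler.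
  by move=> /(_ measurableT [set b p]); rewrite setTI; exact.
rewrite (_ : _ @^-1` _ =
  \big[setI/setT]_(p <- enum {: 'I_N * 'I_N}) [set w | (F p.2 w <= F p.1 w) = b p]).
  exact: bigsetI_measurable.
rewrite -bigcap_seq; apply/seteqP; split => w /=.
  by move=> <- p _ /=; rewrite ffunE.
move=> H; apply/ffunP => p; rewrite ffunE; apply: H.
by rewrite /= mem_enum.
Qed.

Lemma measurable_fj_rep_if i (c : T -> 'I_k) (F s : 'I_N -> T -> R) :
  (forall i, measurable (c @^-1` [set i])) ->
  (forall q, measurable_fun setT (F q)) ->
  (forall q, measurable_fun setT (s q)) ->
  measurable_fun setT (fun w =>
    fj_rep_if sys rec i (c w) (fun q => F q w) (fun q => s q w)).
Proof.
move=> mc mF ms.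
apply: (measurable_fun_finite_choice mc (g := fun c w =>
  fj_rep_if sys rec i c (fun q => F q w) (fun q => s q w))) => c'.
rewrite /fj_rep_if; case: (c' == i) => //; rewrite /fj_rep.
under eq_fun do under eq_bigr do rewrite fj_argmaxE.
apply: (measurable_fun_finite_choice (fun b => measurable_comparisons b mF)
  (g := fun b w => Num.max 0 (\big[Num.min/s (sys i) w]_(j < t)
    s (argmax_of b i j) w))) => b.
by apply: mmax => //; exact: measurable_fun_bigop.
Qed.

End measurability.

(** * Lower and upper limits under a one-sided bound *)

Section limit_bounds.
Context (R : realType).
Implicit Types (u v : nat -> R) (l : R).

Lemma limn_esup_le_cvg_ub u v l : (forall n, u n <= v n) -> v @ \oo --> l ->
  (limn_esup (fun n => (u n)%:E) <= l%:E)%E.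
Proof.
move=> uv vl.
have vlE : (fun n => (v n)%:E) @ \oo --> l%:E.
  by apply: cvg_EFin => //; exact: nearW.
have [_ <-] := cvg_limn_einf_sup vlE.
rewrite !limn_esup_lim; apply: lee_lim.
- exact: is_cvg_esups.
- exact: is_cvg_esups.
apply: nearW => n; apply: ge_ereal_sup => _ [m /= nm <-].
apply: (@le_trans _ _ (v m)%:E); first by rewrite lee_fin.
by apply: ereal_sup_ubound; exists m.
Qed.

Lemma limn_einf_ge_cvg_lb u v l : (forall n, v n <= u n) -> v @ \oo --> l ->
  (l%:E <= limn_einf (fun n => (u n)%:E))%E.
Proof.
move=> vu vl; rewrite /limn_einf leeNr -EFinN.
apply: (@limn_esup_le_cvg_ub (fun n => - u n) (fun n => - v n)).
  by move=> n; rewrite lerN2.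
exact: cvgN.
Qed.

End limit_bounds.

(** * Closure of the events of one random input *)

Section event_families.
Context d (Omega : measurableType d) (R : realType).

Lemma events_of_real_setI (X : Omega -> R) : setI_closed (events_of_real X).
Proof.
move=> _ _ [A mA ->] [B mB ->]; exists (A `&` B); first exact: measurableI.
by rewrite preimage_setI.
Qed.

Lemma events_of_real_setT (X : Omega -> R) : events_of_real X setT.
Proof. by exists setT => //; rewrite preimage_setT. Qed.

Lemma events_of_real_setC (X : Omega -> R) A :
  events_of_real X A -> events_of_real X (~` A).
Proof.
by move=> [B mB ->]; exists (~` B); [exact: measurableC|rewrite preimage_setC].
Qed.

Lemma events_of_real_gt (X : Omega -> R) v :
  events_of_real X [set w | v < X w].
Proof.
exists `]v, +oo[%classic; first exact: measurable_itv.
by apply/seteqP; split => w /=; rewrite in_itv/= andbT.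
Qed.

Lemma events_of_fin_setI (T : finType) (X : Omega -> T) :
  setI_closed (events_of_fin X).
Proof. by move=> _ _ [A ->] [B ->]; exists (A `&` B); rewrite preimage_setI. Qed.

Lemma events_of_fin_setT (T : finType) (X : Omega -> T) : events_of_fin X setT.
Proof. by exists setT; rewrite preimage_setT. Qed.

Lemma events_of_fin_setC (T : finType) (X : Omega -> T) A :
  events_of_fin X A -> events_of_fin X (~` A).
Proof. by move=> [B ->]; exists (~` B); rewrite preimage_setC. Qed.

End event_families.

Section indices.
Variable N : nat.

(* Indices of X_0 .. X_(a-1) and of C_m, S_m for m < b. *)
Definition past_indices (a b : nat) : seq (nat + nat + (nat * 'I_N)) :=
  [seq inl (inl l) | l <- iota 0 a] ++ [seq inl (inr m) | m <- iota 0 b] ++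
  [seq inr mq | mq <- [seq (m, q) | m <- iota 0 b, q <- enum 'I_N]].

Lemma mem_past_indices a b x : (x \in past_indices a b) =
  match x with
  | inl (inl l) => (l < a)%N | inl (inr m) => (m < b)%N | inr (m, _) => (m < b)%N
  end.
Proof.
rewrite !mem_cat; case: x => [[l|m]|[m q]].
- rewrite mem_map; last by move=> ? ? [].
  rewrite mem_iota add0n; case: (l < a)%N => //=.
  by apply/negP => /orP[] /mapP[? _].
- rewrite [X in _ || (X || _)]mem_map; last by move=> ? ? [].
  rewrite mem_iota add0n; case: (m < b)%N; rewrite ?orbT//=.
  by apply/negP => /orP[] /mapP[? _].
- rewrite [X in _ || (_ || X)]mem_map; last by move=> ? ? [].
  have -> : ((m, q) \in [seq (m, q) | m <- iota 0 b, q <- enum 'I_N]) = (m < b)%N.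
    apply/allpairsP/idP => [[[m' q'] /= [+ _ [-> _]]]|mb].
      by rewrite mem_iota.
    by exists (m, q); rewrite mem_iota mem_enum.
  case: (m < b)%N; rewrite ?orbT//= orbF.
  by apply/negP => /orP[] /mapP[? _].
Qed.

Lemma uniq_past_indices a b : uniq (past_indices a b).
Proof.
rewrite !cat_uniq map_inj_uniq ?iota_uniq; last by move=> ? ? [].
rewrite map_inj_uniq ?iota_uniq; last by move=> ? ? [].
rewrite map_inj_uniq; last by move=> ? ? [].
rewrite allpairs_uniq ?iota_uniq ?enum_uniq//= ?andbT; last by move=> [? ?] [? ?].
apply/andP; split; apply/hasPn => x.
  by rewrite mem_cat => /orP[] /mapP[? _ ->]; apply/negP => /mapP[? _].
by move=> /mapP[? _ ->]; apply/negP => /mapP[? _].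
Qed.

End indices.

(** * Almost sure bounds *)

Lemma exprB1n (R : comPzRingType) (x : R) n :
  (1 - x) ^+ n = \sum_(i < n.+1) 'C(n, i)%:R * (-1) ^+ i * x ^+ i.
Proof.
rewrite exprBn; apply: eq_bigr => i _.
by rewrite expr1n mulr1 -mulr_natl mulrA.
Qed.

(* The bound on l is made uniform in j: the extra binomial coefficients vanish. *)
Lemma sum_binomial_widen (R : realType) (t r : nat) (g : nat -> R) :
  \sum_(x : 'I_t.+1 * 'I_(r * t).+1)
    ('C(t, x.1)%:R * (-1) ^+ x.1 * ((-1) ^+ x.2 * 'C(r * x.1, x.2)%:R)) * g x.2 =
  \sum_(j < t.+1) \sum_(l < (r * j).+1)
    ('C(t, j)%:R * (-1) ^+ j * ((-1) ^+ l * 'C(r * j, l)%:R)) * g l.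
Proof.
rewrite -(pair_bigA _ (fun (j : 'I_t.+1) (l : 'I_(r * t).+1) =>
  ('C(t, j)%:R * (-1) ^+ j * ((-1) ^+ l * 'C(r * j, l)%:R)) * g l))/=.
apply: eq_bigr => j _.
have jt : ((r * j).+1 <= (r * t).+1)%N by rewrite ltnS leq_mul2l -ltnS ltn_ord orbT.
rewrite (big_ord_widen (r * t).+1 (fun l : nat =>
  ('C(t, j)%:R * (-1) ^+ j * ((-1) ^+ l * 'C(r * j, l)%:R)) * g l) jt).
rewrite [RHS]big_mkcond/=; apply: eq_bigr => l _; case: ifPn => //.
by rewrite -leqNgt => lj; rewrite (bin_small lj) !mulr0 mul0r.
Qed.

Lemma ae_forall_ord d (T : measurableType d) (R : realType)
    (m : {measure set T -> \bar R}) n (Q : 'I_n -> T -> Prop) :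
  (forall i, {ae m, forall w, Q i w}) -> {ae m, forall w, forall i, Q i w}.
Proof.
move=> H.
have : {ae m, forall w, forall a : nat, forall h : (a < n)%N, Q (Ordinal h) w}.
  apply: ae_foralln => a; have [h|h] : (a < n)%N \/ ~~ (a < n)%N.
      exact/orP/orbN.
    by apply: filterS (H (Ordinal h)) => w Qw h'; rewrite (bool_irrelevance h' h).
  by apply: aeW => w h'; move: h; rewrite h'.
by apply: filterS => w Hw [a h]; exact: Hw.
Qed.

Lemma cvg_sum_ord (R : realType) n (u : 'I_n -> nat -> R) (l : 'I_n -> R) :
  (forall i, u i @ \oo --> l i) ->
  (fun m => \sum_i u i m) @ \oo --> \sum_i l i.
Proof.
move=> H; elim: (index_enum _) => [|i s IH].
  by under eq_fun do rewrite big_nil; rewrite big_nil; exact: cvg_cst.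
by under eq_fun do rewrite big_cons; rewrite big_cons; exact: cvgD.
Qed.

Section fork_join.
Context (R : realType) (k N t r : nat) (r_gt0 : (0 < r)%N).
Variables (sys : 'I_k -> 'I_N) (rec : 'I_k -> 'I_t -> {set 'I_N}).
Hypothesis rec_card : forall i j, #|rec i j| = r.
Hypothesis rec_notin : forall i j, sys i \notin rec i j.
Hypothesis rec_disj : forall i j j' q, j != j' -> q \in rec i j -> q \notin rec i j'.
Variables (lam mu : R) (p : 'I_k -> R).
Hypotheses (lam_gt0 : 0 < lam) (mu_gt0 : 0 < mu).
Hypothesis p_sum : \sum_i p i = 1.
Context d (Omega : measurableType d) (P : probability Omega R).
Variables (X : nat -> Omega -> R) (C : nat -> Omega -> 'I_k)
  (S : nat -> 'I_N -> Omega -> R).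
Hypothesis X_meas : forall n, measurable_fun setT (X n).
Hypothesis S_meas : forall n q, measurable_fun setT (S n q).
Hypothesis C_meas : forall n (B : set 'I_k), measurable (C n @^-1` B).
Hypothesis X_exp : forall n A, measurable A ->
  P (X n @^-1` A) = exponential_prob lam A.
Hypothesis S_exp : forall n q A, measurable A ->
  P (S n q @^-1` A) = exponential_prob mu A.
Hypothesis C_law : forall n i, P (C n @^-1` [set i]) = (p i)%:E.

Let Ev (x : nat + nat + (nat * 'I_N)) : set (set Omega) :=
  match x with
  | inl (inl n) => events_of_real (X n)
  | inl (inr n) => events_of_fin (C n)
  | inr (n, q) => events_of_real (S n q) end.
Hypothesis indep : mutually_independent P Ev.

Let Ev_meas x : Ev x `<=` measurable.
Proof.
case: x => [[n|n]|[n q]] A /=.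
- by move=> [B mB ->]; rewrite -[X in measurable X]setTI; exact: X_meas.
- by move=> [B ->]; exact: C_meas.
- by move=> [B mB ->]; rewrite -[X in measurable X]setTI; exact: S_meas.
Qed.

Let Ev_setI x : setI_closed (Ev x).
Proof.
by case: x => [[n|n]|[n q]]; [exact: events_of_real_setI|
  exact: events_of_fin_setI|exact: events_of_real_setI].
Qed.

Let Ev_setT x : Ev x setT.
Proof.
by case: x => [[n|n]|[n q]]; [exact: events_of_real_setT|
  exact: events_of_fin_setT|exact: events_of_real_setT].
Qed.

Let Ev_setC x A : Ev x A -> Ev x (~` A).
Proof.
by case: x => [[n|n]|[n q]]; [exact: events_of_real_setC|
  exact: events_of_fin_setC|exact: events_of_real_setC].
Qed.

Let cyl a b := cylinders Ev (past_indices N a b).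

Let cyl_meas a b : <<s cyl a b >> `<=` measurable.
Proof.
apply: smallest_sub; first exact: sigma_algebra_measurable.
exact: cylinders_measurable.
Qed.

Let cyl_sub a b a' b' : (a <= a')%N -> (b <= b')%N ->
  <<s cyl a b >> `<=` <<s cyl a' b' >>.
Proof.
move=> aa bb; apply: sub_sigma_algebra2; apply: cylinders_sub => // x.
rewrite !mem_past_indices; case: x => [[l|m]|[m q]] h; exact: leq_trans h _.
Qed.

Let cyl_event a b x A : x \in past_indices N a b -> Ev x A -> <<s cyl a b >> A.
Proof. by move=> xJ EA; apply: sub_sigma_algebra; exact: mem_cylinders EA. Qed.

Let X_wrt a b l : (l < a)%N -> measurable_wrt (cyl a b) (X l).
Proof.
move=> la; apply: measurable_wrtP => B mB.
by apply: (@cyl_event _ _ (inl (inl l))); [rewrite mem_past_indices|exists B].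
Qed.

Let S_wrt a b m q : (m < b)%N -> measurable_wrt (cyl a b) (S m q).
Proof.
move=> mb; apply: measurable_wrtP => B mB.
by apply: (@cyl_event _ _ (inr (m, q))); [rewrite mem_past_indices|exists B].
Qed.

Let C_wrt a b m i : (m < b)%N -> <<s cyl a b >> (C m @^-1` [set i]).
Proof.
move=> mb.
by apply: (@cyl_event _ _ (inl (inr m))); [rewrite mem_past_indices|exists [set i]].
Qed.

Let X_indep n : indep_of P (cyl n.+1 n.+1) (X n.+1).
Proof.
apply: (@cylinders_indep_of _ _ _ _ _ _ _ _ _ indep _ (inl (inl n.+1))) => //.
- by rewrite rcons_uniq uniq_past_indices mem_past_indices ltnn.
- by move=> D mD; exists D.
Qed.

Let A n w := \sum_(l < n.+1) X l w.

Let A_wrt a b m : (m < a)%N -> measurable_wrt (cyl a b) (A m).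
Proof.
elim: m => [|m IH] ma.
  rewrite /A (_ : (fun w => _) = X 0%N); first exact: X_wrt.
  by apply/funext => w; rewrite big_ord1.
have -> : A m.+1 = (fun w => A m w + X m.+1 w).
  by apply/funext => w; rewrite /A big_ord_recr.
apply: (@measurable_funD _ (g_sigma_algebraType (cyl a b)) R setT (A m) (X m.+1)).
  exact: IH (ltnW ma).
exact: X_wrt.
Qed.

Let free n w := fj_free sys rec (A ^~ w) (C ^~ w) (fun m q => S m q w) n.

Let free_wrt n q : measurable_wrt (cyl n.+1 n) (fun w => free n w q).
Proof.
apply: (@measurable_fj_free _ (g_sigma_algebraType (cyl n.+1 n)) R k N t sys rec A C S n).
- by move=> m mn; apply: A_wrt; exact: ltnW.
- by move=> m i mn; exact: C_wrt.
- by move=> m q' mn; exact: S_wrt.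
Qed.

(** One event per index, as the cylinder lemmas require; arrival indices receive [setT] because they
    never enter the tails. *)
Let gt v i (x : nat + nat + (nat * 'I_N)) : set Omega :=
  match x with
  | inl (inl n) => setT
  | inl (inr n) => C n @^-1` [set i]
  | inr (n, q) => [set w | v < S n q w] end.

Let Pgt v i (x : nat + nat + (nat * 'I_N)) : R :=
  match x with
  | inl (inl n) => 1 | inl (inr n) => p i | inr (n, q) => expR (- (mu * v)) end.

Let gt_Ev v i x : Ev x (gt v i x).
Proof.
case: x => [[n|n]|[n q]] /=; first exact: events_of_real_setT.
  by exists [set i].
exact: events_of_real_gt.
Qed.

Let P_gt v i x : 0 <= v -> P (gt v i x) = (Pgt v i x)%:E.
Proof.
move=> v0; case: x => [[n|n]|[n q]] /=.
- by rewrite probability_setT.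
- exact: C_law.
- rewrite -mulNr -exponential_tail// -(S_exp n q); last exact: measurable_itv.
  by congr (P _); apply/seteqP; split => w /=; rewrite in_itv/= andbT.
Qed.

Let service n w := fj_service sys rec (C n w) (fun q => S n q w).

Let service_wrt n : measurable_wrt (cyl n.+1 n.+1) (service n).
Proof.
apply: (@measurable_fj_service _ (g_sigma_algebraType (cyl n.+1 n.+1)) R k N t
  sys rec (C n) (S n)).
- by move=> i; exact: C_wrt.
- by move=> q; exact: S_wrt.
Qed.

(** The systematic service exceeds [v], and so does at least one of the [r] services in each of the
    [t] groups. *)
Let tau v : R := expR (- (mu * v)) * (1 - (1 - expR (- (mu * v))) ^+ r) ^+ t.

Let measurable_gt (V : Omega -> R) v : measurable_fun setT V ->
  measurable [set w | v < V w].
Proof.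
move=> mV; have : measurable_fun setT (fun w => v < V w).
  exact: measurable_fun_ltr.
by move=> /(_ measurableT [set true]); rewrite setTI; exact.
Qed.

(** One computation yields both conclusions: the cylinder [setT] gives the law, and the product form
    on all cylinders and rays extends to independence. Negative [v] is trivial since [V] is
    nonnegative. *)
Let tail_indep a b (V : Omega -> R) (T : R -> R) :
  measurable_fun setT V -> (forall w, 0 <= V w) ->
  (forall D v, cyl a b D -> 0 <= v ->
     P (D `&` [set w | v < V w]) = (P D * (T v)%:E)%E) ->
  (forall v, 0 <= v -> P [set w | v < V w] = (T v)%:E) /\
  indep_of P (cyl a b) V.
Proof.
move=> mV V0 tail.
have PV v : 0 <= v -> P [set w | v < V w] = (T v)%:E.
  move=> v0; have := tail setT v (cylinders_setT Ev_setT _) v0.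
  by rewrite setTI probability_setT mul1e.
split => // D B sD mB.
apply: (@indep_sigma _ _ _ P (cyl a b) (fun=> setT)) => //.
- exact: cylinders_measurable.
- exact: cylinders_setI.
- by move=> n; exact: cylinders_setT.
- by rewrite bigcup_const.
- by rewrite -[X in measurable X]setTI; exact: mV.
move=> {sD}D cD; apply: indep_borel => //.
  exact: cylinders_measurable cD.
move=> v; have [v0|v0] := leP 0 v; first by rewrite PV// tail.
rewrite (_ : [set _ | _] = setT); first by rewrite setIT probability_setT mule1.
by apply/seteqP; split => // w _ /=; exact: lt_le_trans v0 (V0 w).
Qed.

Let fj_service_gt i (s : 'I_N -> R) v : 0 <= v ->
  v < fj_service sys rec i s <->
  v < s (sys i) /\ forall j, exists2 q, q \in rec i j & v < s q.
Proof.
move=> v0; rewrite /fj_service lt_max ltNge v0/=; split.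
  move=> /bigmin_gtP[vs H]; split => // j.
  have /bigmax_gtP[h|[q qj h]] := H j isT; last by exists q.
  by move: h; rewrite ltNge v0.
move=> [vs H]; apply/bigmin_gtP; split => // j _.
by have [q qj h] := H j; apply/bigmax_gtP; right; exists q.
Qed.

Let groups n i : seq (seq (nat + nat + (nat * 'I_N))) :=
  [seq [seq inr (n, q) | q <- enum (rec i j)] | j <- enum 'I_t].

Let own n i : seq (nat + nat + (nat * 'I_N)) := [:: inl (inr n); inr (n, sys i)].

(** Disjointness of the groups from each other and from the systematic server enters here: all the
    services involved are distinct, hence independent, inputs. *)
Let uniq_groups n i : uniq ((past_indices N n.+1 n ++ own n i) ++ flatten (groups n i)).
Proof.
have mem_fl x : x \in flatten (groups n i) ->
    exists q j, q \in rec i j /\ x = inr (n, q).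
  move=> /flattenP[K /mapP[j _ ->] /mapP[q qj ->]].
  by exists q, j; split => //; rewrite mem_enum in qj.
rewrite cat_uniq; apply/and3P; split.
- rewrite cat_uniq; apply/and3P; split => //; first exact: uniq_past_indices.
  apply/hasPn => x xo; apply/negP => /= xp; move: xp xo.
  by rewrite mem_past_indices !inE => + /orP[] /eqP xE; rewrite xE ltnn.
- apply/hasPn => x /mem_fl[q [j [qj ->]]]; apply/negP => xp.
  have : inr (n, q) \in past_indices N n.+1 n ++ own n i by exact: xp.
  rewrite mem_cat mem_past_indices ltnn/= !inE/= => /eqP[qE].
  by have := rec_notin i j; rewrite -qE qj.
- rewrite /groups; elim: (enum 'I_t) (enum_uniq 'I_t) => //= j s IH /andP[js us].
  rewrite cat_uniq IH// andbT map_inj_uniq ?enum_uniq/=; last by move=> ? ? [].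
  apply/hasPn => x /flattenP[K /mapP[j' j's ->] /mapP[q qj' ->]].
  apply/negP => /mapP[q' q'j [qE]]; rewrite -qE !mem_enum in qj' q'j.
  have jj : j' != j by apply/eqP => jE; rewrite -jE j's in js.
  by have := rec_disj jj qj'; rewrite q'j.
Qed.

Let P_own n i v : 0 <= v -> P (\big[setI/setT]_(x <- own n i) gt v i x) =
  (p i * expR (- (mu * v)))%:E.
Proof.
move=> v0; rewrite (prob_bigI indep _ (gt_Ev v i))//.
by rewrite !big_cons big_nil mule1 !P_gt// -EFinM.
Qed.

Let prod_groups n i v : \prod_(K <- groups n i) (1 - \prod_(x <- K) (1 - Pgt v i x)) =
  (1 - (1 - expR (- (mu * v))) ^+ r) ^+ t.
Proof.
rewrite /groups big_map -[in RHS](card_ord t) -prodr_const big_enum/=.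
apply: eq_bigr => j _; congr (1 - _).
by rewrite big_map big_enum/= prodr_const rec_card.
Qed.

(** Once the file is fixed, the event is the intersection of its own two events with one union per
    group, the shape handled by [prob_inter_unions]. The answer depends on the file only through
    [p i], and these sum to 1. *)
Let service_tail n D v : cyl n.+1 n D -> 0 <= v ->
  P (D `&` [set w | v < service n w]) = (P D * (tau v)%:E)%E.
Proof.
move=> cD v0; set e := expR (- (mu * v)).
have mD : measurable D by exact: cylinders_measurable cD.
have mV : measurable [set w | v < service n w].
  by apply: measurable_gt; exact: (measurable_wrt_fun (@cyl_meas n.+1 n.+1)).
rewrite (@probability_partition _ _ _ P _ (C n)); last 2 first.
- by move=> i; exact: C_meas.
- exact: measurableI.
have PDf : P D \is a fin_num by rewrite fin_num_measure.
transitivity (\sum_i (fine (P D) * (p i * e) * (1 - (1 - e) ^+ r) ^+ t)%:E)%E.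
  apply: eq_bigr => i _.
  pose D' := D `&` \big[setI/setT]_(x <- own n i) gt v i x.
  have cown : cylinders Ev (own n i) (\big[setI/setT]_(x <- own n i) gt v i x).
    by exists (gt v i) => // x; exact: gt_Ev.
  have un := uniq_groups n i.
  have cD' : cylinders Ev (past_indices N n.+1 n ++ own n i) D'.
    apply: cylinders_setI => //.
      by apply: cylinders_sub cD => // x xJ; rewrite mem_cat xJ.
    by apply: cylinders_sub cown => // x xJ; rewrite mem_cat xJ orbT.
  transitivity (P (D' `&` \big[setI/setT]_(K <- groups n i)
      \big[setU/set0]_(x <- K) gt v i x)).
    congr (P _); rewrite /D' !big_cons big_nil setIT -setIA -setIA.
    congr (_ `&` _); rewrite /groups big_map -bigcap_seq.
    apply/seteqP; split => w /=.
      move=> [vs Cw]; rewrite /service Cw in vs.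
      have [vs0 vsj] := (fj_service_gt i (fun q => S n q w) v0).1 vs.
      do 2?split => //; move=> j _; have [q qj vq] := vsj j.
      rewrite big_map -bigcup_seq; exists q => //=.
      by rewrite mem_enum.
    move=> [[Cw vs] H]; split => //; rewrite /service Cw.
    apply/(fj_service_gt i (fun q => S n q w) v0); split => // j.
    have := H j; rewrite /= mem_enum big_map -bigcup_seq => /(_ isT) [q qj vq].
    by exists q => //; rewrite /= mem_enum in qj.
  rewrite (prob_inter_unions Ev_meas Ev_setI Ev_setT Ev_setC indep (gt_Ev v i)
    (fun x => P_gt i x v0) un cD').
  rewrite /D' (cylinders_indep indep _ cD cown); last first.
    by have /andP[] : uniq (past_indices N n.+1 n ++ own n i) && _ :=
      etrans (esym (cat_uniq _ _)) un.
  by rewrite P_own// prod_groups -(fineK PDf) -!EFinM.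
rewrite sumEFin -(fineK PDf) -EFinM; congr EFin.
rewrite -mulr_suml -mulr_sumr -mulr_suml p_sum mul1r /tau -/e.
by rewrite mulrA.
Qed.

Let mservice n : measurable_fun setT (service n).
Proof. exact: measurable_wrt_fun (@cyl_meas n.+1 n.+1) (@service_wrt n). Qed.

Let service_ge0 n w : 0 <= service n w.
Proof. by rewrite /service /fj_service le_max lexx. Qed.

Let service_law n := tail_indep (@mservice n) (@service_ge0 n) (@service_tail n).

(** Coefficients of [tau] after expanding both powers in [exp (- mu v)]. The second index runs to
    [r * t] for every [j], so that one finite type indexes the mixture. *)
Let cc (x : 'I_t.+1 * 'I_(r * t).+1) : R :=
  'C(t, x.1)%:R * (-1) ^+ x.1 * ((-1) ^+ x.2 * 'C(r * x.1, x.2)%:R).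
Let aa (x : 'I_t.+1 * 'I_(r * t).+1) : R := x.2.+1%:R * mu.

Let tauE v : tau v = \sum_x cc x * expR (- (aa x * v)).
Proof.
rewrite (sum_binomial_widen t r (fun l => expR (- (l.+1%:R * mu * v)))) /tau.
rewrite exprB1n mulr_sumr; apply: eq_bigr => j _.
rewrite -exprM exprB1n !mulr_sumr; apply: eq_bigr => l _.
have -> : expR (- (l.+1%:R * mu * v)) = expR (- (mu * v)) ^+ l.+1.
  by rewrite -expRM_natl mulrN -mulrA.
rewrite exprS; ring.
Qed.

Let eta := (mu * r%:R)^-1 * betaR (t.+1%:R) (r%:R^-1) : R.
Let sig := \sum_(j < t.+1) 'C(t, j)%:R * (-1) ^+ j *
  \sum_(l < (r * j).+1) (-1) ^+ l * 'C(r * j, l)%:R / (l.+1%:R ^+ 2) : R.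

Let service_moments n : (\int[P]_w (service n w)%:E = eta%:E)%E /\
  (\int[P]_w (service n w ^+ 2)%:E = (2 / mu ^+ 2 * sig)%:E)%E.
Proof.
have [||||-> ->] := @moments_exponential_tail R _ _ P _ cc aa (service n).
- by move=> x; rewrite mulr_gt0.
- exact: mservice.
- exact: service_ge0.
- by move=> v v0; rewrite -tauE; exact: (service_law n).1.
split; congr EFin.
  rewrite (sum_binomial_widen t r (fun l => (l.+1%:R * mu)^-1)).
  by rewrite /eta eta_binomial.
rewrite (sum_binomial_widen t r (fun l => 2 / (l.+1%:R * mu) ^+ 2)).
rewrite /sig mulr_sumr; apply: eq_bigr => j _.
rewrite mulrCA !mulr_sumr; apply: eq_bigr => l _.
have : l.+1%:R != 0 :> R by rewrite pnatr_eq0.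
by move: (l.+1%:R) => x x0; field; rewrite x0 gt_eqF.
Qed.

(** The dominating server [c w] may depend on the path; summing over all servers removes this
    dependence. *)
Let moment_le n (V : Omega -> R) (c : Omega -> 'I_N) m :
  measurable_fun setT V -> (forall w, 0 <= V w) ->
  (forall w, V w <= `|S n (c w) w|) ->
  (\int[P]_w (V w ^+ m)%:E <= (\sum_(q < N) (m`!%:R * (2 / mu) ^+ m * 2))%:E)%E.
Proof.
move=> mV V0 VS.
have mSm q : measurable_fun setT (fun w => (`|S n q w| ^+ m)%:E).
  apply/measurable_EFinP; apply: measurable_funX.
  exact: measurableT_comp.
apply: (@le_trans _ _ (\int[P]_w (\sum_(q < N) (`|S n q w| ^+ m)%:E))%E).
  apply: ge0_le_integral => //.
  - by move=> w _; rewrite lee_fin exprn_ge0.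
  - exact/measurable_EFinP/measurable_funX.
  - by apply: emeasurable_sum.
  - move=> w _; rewrite sumEFin lee_fin (bigD1 (c w))//=.
    apply: ler_wpDr; first by apply: sumr_ge0 => q _; rewrite exprn_ge0.
    by apply: lerXn2r; rewrite ?nnegrE.
rewrite ge0_integral_sum//.
rewrite -sumEFin; apply: lee_sum => q _; apply: exponential_moment_le => //.
exact: S_exp.
Qed.

Let lindley_law n m (y : R) : 0 <= y ->
  (\int[P]_w (Num.max 0 (y - X n.+1 w) ^+ m.+2 +
    m.+2%:R / lam * Num.max 0 (y - X n.+1 w) ^+ m.+1)%:E = (y ^+ m.+2)%:E)%E.
Proof. by move=> y0; apply: exponential_lindley_moment => //; exact: X_exp. Qed.


Let ae_gt0 (Z : Omega -> R) (a : R) : 0 < a -> measurable_fun setT Z ->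
  (forall A, measurable A -> P (Z @^-1` A) = exponential_prob a A) ->
  {ae P, forall w, 0 <= Z w}.
Proof.
move=> a0 mZ hZ; exists (~` [set w | 0 < Z w]).
have mZ0 := measurable_gt 0 mZ; split.
- exact: measurableC.
- rewrite probability_setC// (_ : P [set w | 0 < Z w] = 1%E) ?subee//.
  rewrite -[1%E](_ : exponential_prob a `]0, +oo[ = _); last first.
    by rewrite exponential_tail// mulr0 expR0.
  rewrite -hZ; last exact: measurable_itv.
  by congr (P _); apply/seteqP; split => w /=; rewrite in_itv/= andbT.
- by move=> w /= Zw Z0; apply: Zw; exact: ltW.
Qed.

Lemma fork_join_upper : lam < eta^-1 ->
  {ae P, forall w, (limn_esup (fun n => (fj_avg sys rec (X ^~ w) (C ^~ w)
      (fun n q => S n q w) n)%:E) <=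
    (eta + lam * sig / (mu ^+ 2 * (1 - lam * eta)))%:E)%E}.
Proof.
move=> leta.
have eta0 : 0 <= eta.
  rewrite -lee_fin -(service_moments 0).1.
  by apply: integral_ge0 => w _; rewrite lee_fin service_ge0.
have lv : lam * eta < 1.
  have [e0|en0] := eqVneq eta 0; first by rewrite e0 mulr0.
  by rewrite -ltr_pdivlMr ?div1r// lt_neqAle eq_sym en0.
have hB n m : (\int[P]_w (service n w ^+ m)%:E <=
    (\sum_(q < N) (m`!%:R * (2 / mu) ^+ m * 2))%:E)%E.
  apply: (@moment_le n (service n) (fun w => sys (C n w))) => // w.
  by rewrite /service /fj_service ge_max normr_ge0/=;
    apply: le_trans (ler_norm _); exact: bigmin_le_id.
(* [cyl n.+1 n] contains arrival [n] but not its file and services, which [cyl n.+1 n.+1] adds; the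
   next interarrival time is [X n.+1]. *)
have aeC := lindley_cesaro (fun n => @cyl_meas n.+1 n.+1)
  (fun n => @cyl_sub n.+1 n n.+1 n.+1 (leqnn _) (leqnSn _))
  (fun n => @cyl_sub n.+1 n.+1 n.+2 n.+1 (leqnSn _) (leqnn _))
  service_wrt (fun n => @X_wrt n.+2 n.+1 n.+1 (ltnSn _))
  (fun n => (service_law n).2) X_indep service_ge0 lam_gt0 lv lindley_law
  (fun n => (service_moments n).1) (fun n => (service_moments n).2) hB
  (fun n => (service_law n).1 0 (lexx 0)).
apply: filterS2 (ae_gt0 lam_gt0 (@X_meas 0) (X_exp 0)) aeC => w X0 [cvgT _].
apply: (limn_esup_le_cvg_ub (v := fun n => n.+1%:R^-1 * \sum_(0 <= m < n.+1)
     (lindley (service ^~ w) (fun m => X m.+1 w) m + service m w))).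
  move=> n; rewrite /fj_avg ler_wpM2l// big_mkord.
  by apply: ler_sum => m _; exact: fj_download_le.
rewrite (_ : eta + _ = lam * (2 / mu ^+ 2 * sig) / (2 * (1 - lam * eta)) + eta)//.
have h : 1 - lam * eta != 0 by rewrite subr_eq0 gt_eqF.
by rewrite addrC; congr (_ + _); field; rewrite h gt_eqF.
Qed.

Let rep i n w := fj_rep_if sys rec i (C n w) (free n w) (fun q => S n q w).

Let rep_wrt i n : measurable_wrt (cyl n.+1 n.+1) (rep i n).
Proof.
apply: (@measurable_fj_rep_if _ (g_sigma_algebraType (cyl n.+1 n.+1)) R k N t
  sys rec i (C n) (fun q w => free n w q) (S n)).
- by move=> j; exact: C_wrt.
- move=> q.
  exact: measurable_wrtS (@cyl_sub n.+1 n n.+1 n.+1 (leqnn _) (leqnSn _)) (@free_wrt n q).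
- by move=> q; exact: S_wrt.
Qed.

Let mrep i n : measurable_fun setT (rep i n).
Proof. exact: measurable_wrt_fun (@cyl_meas n.+1 n.+1) (@rep_wrt i n). Qed.

Let rep_ge0 i n w : 0 <= rep i n w.
Proof. by rewrite /rep /fj_rep_if; case: ifP => // _; rewrite le_max lexx. Qed.

Let rec_neq0 i j : rec i j != finset.set0.
Proof. by rewrite -card_gt0 rec_card. Qed.

(** On each value of the comparison table the selected servers are constants, and that event lies in
    the past. The tail is then that of a file choice and [t + 1] distinct fresh services, the same
    for every table. *)
Let rep_tail i n D v : cyl n.+1 n D -> 0 <= v ->
  P (D `&` [set w | v < rep i n w]) =
  (P D * (p i * expR (- (t.+1%:R * mu * v)))%:E)%E.
Proof.
move=> cD v0; set e := expR (- (mu * v)).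
have mD : measurable D by exact: cylinders_measurable cD.
have sD : <<s cyl n.+1 n >> D by exact: sub_sigma_algebra.
have eE : expR (- (t.+1%:R * mu * v)) = e * e ^+ t.
  by rewrite -exprS -expRM_natl mulrN -mulrA.
pose b w := comparisons (free n w).
have sb beta : <<s cyl n.+1 n >> (b @^-1` [set beta]).
  apply: (@measurable_comparisons _ (g_sigma_algebraType (cyl n.+1 n)) R N
    (fun q w => free n w q)).
  by move=> q; exact: free_wrt.
have mb beta : measurable (b @^-1` [set beta]) by exact: cyl_meas (sb beta).
rewrite (@probability_partition _ _ _ P _ b) //; last first.
  by apply: measurableI => //; exact: measurable_gt.
rewrite [X in (X * _)%E](@probability_partition _ _ _ P _ b) //.
rewrite ge0_sume_distrl//; apply: eq_bigr => beta _.
pose sel j := argmax_of sys rec beta i j.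
(* Tables selecting a server outside its group come from no vector of free times, so their event is
   empty. *)
have [valid|/existsNP[j invalid]] := pselect (forall j, sel j \in rec i j); last first.
  rewrite (_ : b @^-1` [set beta] = set0) ?setI0 ?measure0 ?mul0e//.
  apply/seteqP; split => // w /= bw; apply: invalid.
  by rewrite /sel -bw -fj_argmaxE; have [] := fj_argmaxP sys (free n w) (rec_neq0 i j).
pose L := own n i ++ [seq inr (n, sel j) | j <- enum 'I_t].
have uL : uniq (past_indices N n.+1 n ++ L).
  rewrite cat_uniq; apply/and3P; split.
  - exact: uniq_past_indices.
  - apply/hasPn => x xL; apply/negP => xp.
    have : x \in past_indices N n.+1 n by exact: xp.
    rewrite mem_past_indices => xm; move: xL; rewrite mem_cat.
    by move=> /orP[|/mapP[j _ xE]]; [rewrite !inE => /orP[] /eqP xE|];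
      move: xm; rewrite xE ltnn.
  - rewrite /L cat_uniq; apply/and3P; split => //.
      apply/hasPn => _ /mapP[j _ ->]; apply/negP => so.
      have : inr (n, sel j) \in own n i by exact: so.
      rewrite !inE/= => /eqP[sE].
      by have := rec_notin i j; rewrite -sE valid.
    rewrite map_inj_uniq ?enum_uniq// => j j' [] jj.
    apply/eqP/negPn/negP => jn.
    by have := rec_disj jn (valid j); rewrite jj valid.
have cL : cylinders Ev L (\big[setI/setT]_(x <- L) gt v i x).
  by exists (gt v i) => // x; exact: gt_Ev.
transitivity (P (D `&` b @^-1` [set beta] `&` \big[setI/setT]_(x <- L) gt v i x)).
  congr (P _); rewrite -setIA -[in RHS]setIA; congr (_ `&` _); rewrite setIC.
  rewrite /L big_cat/= !big_cons big_nil setIT big_map -bigcap_seq.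
  have gtE w : b w = beta -> v < rep i n w <->
      (C n w = i /\ v < S n (sys i) w) /\ forall j, v < S n (sel j) w.
    move=> bw; rewrite /rep /fj_rep_if; case: eqP => [Cw|Cw]; last first.
      by rewrite ltNge v0; split => // -[[]].
    rewrite /fj_rep lt_max ltNge v0/=.
    have selE j : fj_argmax sys rec (free n w) i j = sel j.
      by rewrite fj_argmaxE -/(b w) bw.
    split=> [/bigmin_gtP[vs H]|[[_ vs] H]].
      by split => // j; have := H j isT; rewrite selE.
    by apply/bigmin_gtP; split => // j _; rewrite selE.
  apply/seteqP; split => w /= [bw].
    by move=> /(gtE w bw)[[Cw vs] H]; split => //; split => // j _; exact: H.
  move=> [[Cw vs] H]; split => //; apply/(gtE w bw); split => // j.
  by apply: H; rewrite /= mem_enum.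
rewrite (cylinders_sigma_indep Ev_meas Ev_setI Ev_setT indep uL _ cL); last first.
  have mI := @measurableI _ (g_sigma_algebraType (cyl n.+1 n)).
  exact: (mI _ _ sD (sb beta)).
congr (_ * _)%E; rewrite (prob_bigI indep _ (gt_Ev v i)); last first.
  by move: uL; rewrite cat_uniq => /and3P[].
rewrite /L big_cat/= !big_cons big_nil mule1 !P_gt// big_map.
under eq_bigr do rewrite P_gt//=.
rewrite prodEFin -!EFinM eE mulrA; congr (_ * _)%:E.
by rewrite big_enum/= prodr_const card_ord.
Qed.

Let rep_law i n := tail_indep (@mrep i n) (@rep_ge0 i n) (@rep_tail i n).

(** A mixture with a single exponential of weight [p i]; the remaining mass sits at 0 and adds
    nothing to the moments. *)
Let rep_moments i n : (\int[P]_w (rep i n w)%:E = (p i / (t.+1%:R * mu))%:E)%E /\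
  (\int[P]_w (rep i n w ^+ 2)%:E = (p i * (2 / (t.+1%:R * mu) ^+ 2))%:E)%E.
Proof.
have [||||-> ->] := @moments_exponential_tail R _ _ P 'I_1 (fun=> p i)
  (fun=> t.+1%:R * mu) (rep i n).
- by move=> _; rewrite mulr_gt0.
- exact: mrep.
- exact: rep_ge0.
- by move=> v v0; rewrite big_ord1; exact: (rep_law i n).1.
by rewrite !big_ord1.
Qed.

Let rep_cesaro i : p i * lam < t.+1%:R * mu -> {ae P, forall w,
  (fun n => n.+1%:R^-1 * \sum_(0 <= m < n.+1)
     ((0 < rep i m w)%R%:R * lindley (rep i ^~ w) (fun m => X m.+1 w) m + rep i m w))
   @ \oo --> p i / (t.+1%:R * mu - p i * lam)}.
Proof.
move=> plam; have nu0 : 0 < t.+1%:R * mu by rewrite mulr_gt0.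
have lv : lam * (p i / (t.+1%:R * mu)) < 1.
  by rewrite mulrA ltr_pdivrMr// mul1r mulrC.
have hB n m : (\int[P]_w (rep i n w ^+ m)%:E <=
    (\sum_(q < N) (m`!%:R * (2 / mu) ^+ m * 2))%:E)%E.
  apply: (@moment_le n (rep i n) (fun w => sys i)) => // w.
  rewrite /rep /fj_rep_if; case: ifP => // _; rewrite /fj_rep ge_max normr_ge0/=.
  by apply: le_trans (ler_norm _); exact: bigmin_le_id.
have P0 n : P [set w | 0 < rep i n w] = (p i)%:E.
  by rewrite (rep_law i n).1// mulr0 oppr0 expR0 mulr1.
have := lindley_cesaro (fun n => @cyl_meas n.+1 n.+1)
  (fun n => @cyl_sub n.+1 n n.+1 n.+1 (leqnn _) (leqnSn _))
  (fun n => @cyl_sub n.+1 n.+1 n.+2 n.+1 (leqnSn _) (leqnn _))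
  (@rep_wrt i) (fun n => @X_wrt n.+2 n.+1 n.+1 (ltnSn _))
  (fun n => (rep_law i n).2) X_indep (@rep_ge0 i) lam_gt0 lv lindley_law
  (fun n => (rep_moments i n).1) (fun n => (rep_moments i n).2) hB P0.
apply: filterS => w [_].
set l := (X in _ --> X -> _).
rewrite (_ : l = p i / (t.+1%:R * mu - p i * lam))// /l.
have : t.+1%:R * mu - p i * lam != 0 by rewrite subr_eq0 gt_eqF.
move: (t.+1%:R * mu) nu0 => nu nu0 h; field.
rewrite h !gt_eqF//=.
Qed.

Lemma fork_join_lower : (forall i, p i * lam < t.+1%:R * mu) ->
  {ae P, forall w, ((\sum_(i < k) p i / (t.+1%:R * mu - p i * lam))%:E <=
     limn_einf (fun n => (fj_avg sys rec (X ^~ w) (C ^~ w)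
       (fun n q => S n q w) n)%:E))%E}.
Proof.
move=> plam.
have aeX : {ae P, forall w, forall n, 0 <= X n w}.
  by apply: ae_foralln => n; exact: ae_gt0 lam_gt0 (@X_meas n) (X_exp n).
have aeS : {ae P, forall w, forall n q, 0 <= S n q w}.
  apply: ae_foralln => n; apply: ae_forall_ord => q.
  exact: ae_gt0 mu_gt0 (@S_meas n q) (S_exp n q).
have aeC := ae_forall_ord (fun i => rep_cesaro (plam i)).
apply: filterS3 aeX aeS aeC => w X0 S0 cvgT.
apply: (limn_einf_ge_cvg_lb (v := fun n => \sum_(i < k) (n.+1%:R^-1 *
   \sum_(0 <= m < n.+1) ((0 < rep i m w)%R%:R *
     lindley (rep i ^~ w) (fun m => X m.+1 w) m + rep i m w)))).
  move=> n; rewrite -mulr_sumr exchange_big/= /fj_avg ler_wpM2l// big_mkord.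
  apply: ler_sum => m _.
  exact: (@fj_download_ge_sum R k N t sys rec rec_neq0 (X ^~ w) (C ^~ w)
    (fun n q => S n q w) m X0 S0).
exact: cvg_sum_ord.
Qed.

End fork_join.

Theorem theorem3
  (R : realType) (k N t r : nat) (k_gt0 : (0 < k)%N) (r_gt0 : (0 < r)%N)
  (* storage: systematic (N,k) linear code over a field, one symbol/server *)
  (F : fieldType) (G : 'M[F]_(k, N))
  (sys : 'I_k -> 'I_N) (rec : 'I_k -> 'I_t -> {set 'I_N})
  (sys_inj : injective sys)
  (G_sys : forall i i' : 'I_k, G i' (sys i) = (i' == i)%:R)
  (rec_card : forall i j, #|rec i j| = r)
  (rec_notin : forall i j, sys i \notin rec i j)
  (rec_disj : forall i j j' q, j != j' -> q \in rec i j -> q \notin rec i j')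
  (rec_recover : forall i j, exists a : 'I_N -> F,
      forall i' : 'I_k, G i' (sys i) = \sum_(q in rec i j) a q * G i' q)
  (* parameters *)
  (lam mu : R) (lam_gt0 : 0 < lam) (mu_gt0 : 0 < mu)
  (p : 'I_k -> R) (p_ge0 : forall i, 0 <= p i) (p_sum : \sum_i p i = 1)
  (* randomness *)
  (d : measure_display) (Omega : measurableType d) (P : probability Omega R)
  (X : nat -> Omega -> R) (C : nat -> Omega -> 'I_k)
  (S : nat -> 'I_N -> Omega -> R)
  (X_meas : forall n, measurable_fun setT (X n))
  (S_meas : forall n q, measurable_fun setT (S n q))
  (C_meas : forall n (B : set 'I_k), measurable (C n @^-1` B))
  (X_exp : forall n A, measurable A -> P (X n @^-1` A) = exponential_prob lam A)
  (S_exp : forall n q A, measurable A ->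
      P (S n q @^-1` A) = exponential_prob mu A)
  (C_law : forall n i, P (C n @^-1` [set i]) = (p i)%:E)
  (indep : mutually_independent P
     (fun x : nat + nat + (nat * 'I_N) => match x with
        | inl (inl n) => events_of_real (X n)
        | inl (inr n) => events_of_fin (C n)
        | inr (n, q) => events_of_real (S n q) end)) :
  let avg w := fj_avg sys rec (fun n => X n w) (fun n => C n w)
                 (fun n q => S n q w) in
  let eta := (mu * r%:R)^-1 * betaR (t.+1%:R) (r%:R^-1) in
  (lam < t.+1%:R * mu / \big[Num.max/0]_(i < k) p i ->
     {ae P, forall w, ((\sum_(i < k) p i / (t.+1%:R * mu - p i * lam))%:E
                        <= limn_einf (fun n => (avg w n)%:E))%E}) /\
  (lam < eta^-1 ->
     {ae P, forall w, (limn_esup (fun n => (avg w n)%:E) <=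
        (eta + lam * (\sum_(j < t.+1) 'C(t, j)%:R * (-1) ^+ j *
             \sum_(l < (r * j).+1) (-1) ^+ l * 'C(r * j, l)%:R / (l.+1%:R ^+ 2))
          / (mu ^+ 2 * (1 - lam * eta)))%:E)%E}).
Proof.
move=> avg eta; split=> [lam_lt|lam_lt].
- have H := (fork_join_lower r_gt0 rec_card rec_notin rec_disj lam_gt0 mu_gt0
    X_meas S_meas C_meas X_exp S_exp C_law indep).
  rewrite /avg; apply: H => i.
  have pM : p i <= \big[Num.max/0]_(i < k) p i by exact: le_bigmax.
  have M0 : 0 <= \big[Num.max/0]_(i < k) p i by exact: bigmax_ge_id.
  move: (\big[Num.max/0]_(i < k) p i) pM M0 lam_lt => M pM.
  rewrite le_eqVlt => /orP[/eqP <-|M0 lam_lt].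
    (* If the maximum were 0, the convention [0^-1 = 0] would turn the assumption into [lam < 0]. *)
    by rewrite invr0 mulr0 => /lt_trans/(_ lam_gt0); rewrite ltxx.
  apply: (@le_lt_trans _ _ (lam * M)); first by rewrite mulrC ler_wpM2l// ltW.
  by rewrite -ltr_pdivlMr.
- exact: (fork_join_upper r_gt0 rec_card rec_notin rec_disj lam_gt0 mu_gt0 p_sum
    X_meas S_meas C_meas X_exp S_exp C_law indep lam_lt).
Qed.
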